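(* Let $\mathfrak g$ be a compact simple Lie algebra, $\sigma=\mathrm{Ad}(\exp(\pi/2)\sqrt{-1}K_i)$ for some simple root $\alpha_i$ with $m_i=3$ or $4$, and $\mathfrak h=\mathfrak g^\sigma$. For any involutive automorphism $\tau$ of $\mathfrak g$ satisfying $\tau(\mathfrak h)=\mathfrak h$, there exists $\mu\in\mathrm{Int}(\mathfrak h)$ such that $\mu\circ\tau\circ\mu^{-1}(\Pi(\mathfrak h))=\Pi(\mathfrak h)$ (that is, $\mu\circ\tau\circ\mu^{-1}$ preserves $\mathfrak t$ and its induced action on roots permutes $\Pi(\mathfrak h)$).
   Context: $\mathfrak t$ is a maximal abelian subalgebra of $\mathfrak g$ contained in $\mathfrak h$, $\Pi=\{\alpha_1,\dots,\alpha_n\}$ a set of simple roots of $(\mathfrak g_{\mathbb C},\mathfrak t_{\mathbb C})$, $\delta=\sum_jm_j\alpha_j$ the highest root, $\alpha_0=-\delta$, and $K_j\in\mathfrak t_{\mathbb C}$ is defined by $\alpha_i(K_j)=\delta_{ij}$. $\Pi(\mathfrak h)$ is the simple root system of $\mathfrak h$ with respect to $\mathfrak t$: $\Pi(\mathfrak h)=\{\alpha_j:1\le j\le n,\ j\neq i\}$ if $m_i=3$, and $\Pi(\mathfrak h)=\{\alpha_0\}\cup\{\alpha_j:1\le j\le n,\ j\ne i\}$ if $m_i=4$. $\mathrm{Int}(\mathfrak h)$ is the group of inner automorphisms of $\mathfrak g$ generated by $e^{\mathrm{ad}X}$, $X\in\mathfrak h$. *)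

(* Defs.v *)
From HB Require Import structures.
From mathcomp Require Import all_boot all_order all_algebra.
From mathcomp Require Import complex ring.
From mathcomp Require Import all_classical all_reals all_analysis.

Set Implicit Arguments.
Unset Strict Implicit.
Unset Printing Implicit Defensive.

Import Order.TTheory GRing.Theory Num.Theory passmx.
Import numFieldNormedType.Exports.
Local Open Scope classical_set_scope.
Local Open Scope ring_scope.
Local Open Scope complex_scope.

HB.mixin Record Vector_isLieAlgebra (K : fieldType) V of Vector K V := {
  lie : V -> V -> V;
  lie_linear_l : forall x : V, linear (lie^~ x);
  lie_linear_r : forall x : V, linear (lie x);
  liexx : forall x : V, lie x x = 0;
  jacobi : forall x y z : V,
    lie x (lie y z) + lie y (lie z x) + lie z (lie x y) = 0
}.

#[short(type="lieAlgType")]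
HB.structure Definition LieAlgebra (K : fieldType) :=
  { V of Vector_isLieAlgebra K V & Vector K V }.

HB.instance Definition _ (K : fieldType) (g : lieAlgType K) (x : g) :=
  GRing.isLinear.Build K g g _ (lie x) (lie_linear_r x).

Section LieAlgebraTheory.
Variables (K : fieldType) (g : lieAlgType K).
Implicit Types (x y : g) (f : 'End(g)) (s : {vspace g}).

Fact lieDl x y z : lie (x + y) z = lie x z + lie y z.
Proof. by have := lie_linear_l z 1 x y; rewrite !scale1r. Qed.

Fact lieZl a x z : lie (a *: x) z = a *: lie x z.
Proof.
have lie0 : lie 0 z = 0 :> g by apply/(addrI (lie 0 z)); rewrite -lieDl !addr0.
by have := lie_linear_l z a x 0; rewrite !addr0 lie0 addr0.
Qed.

Fact lieNl x z : lie (- x) z = - lie x z.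
Proof. by rewrite -scaleN1r lieZl scaleN1r. Qed.

Fact lie_anti x y : lie x y = - lie y x.
Proof.
by apply/eqP; rewrite -subr_eq0 opprK; have /eqP := liexx (x + y);
  rewrite lieDl !linearD /= !liexx add0r addr0.
Qed.

Fact lieDr x y z : lie x (y + z) = lie x y + lie x z.
Proof. exact: linearD. Qed.

Fact lieZr a x y : lie x (a *: y) = a *: lie x y.
Proof. exact: linearZ. Qed.

Fact lieNr x y : lie x (- y) = - lie x y.
Proof. exact: linearN. Qed.

Definition lieE := (lieDl, lieNl, lieZl, lieDr, lieNr, lieZr).

Definition ad x : 'End(g) := linfun (lie x).

Definition trace_end f : K :=
  \tr (mxof (vbasis {:g}) (vbasis {:g}) f).

Definition killing x y : K := trace_end (ad x \o ad y)%VF.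

Definition abelian_subalg s :=
  forall x y, x \in s -> y \in s -> lie x y = 0.

Definition max_abelian_subalg s :=
  abelian_subalg s /\
  forall s', abelian_subalg s' -> (s <= s')%VS -> s' = s.

Definition lie_ideal s := forall x y, y \in s -> lie x y \in s.

Definition simple_lie :=
  (exists x y, lie x y != 0) /\
  forall s, lie_ideal s -> s = 0%VS \/ s = fullv.

Definition lie_automorphism f :=
  lker f = 0%VS /\ forall x y, f (lie x y) = lie (f x) (f y).

(* involutive in the sense that f^2 is the identity; f = id is allowed *)
Definition involutive_automorphism f :=
  lie_automorphism f /\ (f \o f)%VF = \1%VF.

End LieAlgebraTheory.

Section RealLieAlgebra.
Variables (R : realType) (g : lieAlgType R).
Implicit Types (x : g) (f : 'End(g)) (s : {vspace g}).

(* compactness of a semisimple Lie algebra: negative definite Killing form *)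
Definition compact_lie := forall x, x != 0 -> killing x x < 0.

Definition expmx d (A : 'M[R]_d) : 'M[R]_d :=
  lim ((fun N => \sum_(0 <= k < N) (k`!%:R^-1 : R) *: A ^+ k) @ \oo).

Definition exp_end f : 'End(g) :=
  let e := vbasis {:g} in hommx e e (expmx (mxof e e f)).

Inductive Int_group s : 'End(g) -> Prop :=
| Int_exp x : x \in s -> Int_group s (exp_end (ad x))
| Int_id : Int_group s \1%VF
| Int_comp f1 f2 : Int_group s f1 -> Int_group s f2 -> Int_group s (f1 \o f2)%VF
| Int_inv f : Int_group s f -> Int_group s (f^-1)%VF.

End RealLieAlgebra.

Fact coord_inj (K : fieldType) (V : vectType K) (u v : V) :
  (forall j, coord (vbasis {:V}) j u = coord (vbasis {:V}) j v) -> u = v.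
Proof.
move=> uv; rewrite (coord_vbasis (memvf u)) (coord_vbasis (memvf v)).
by apply: eq_bigr => j _; rewrite uv.
Qed.

Fact regular_scaleE (K : fieldType) (a b : K) : a *: (b : K^o) = a * b.
Proof. by []. Qed.

(* proves identities between linear combinations of vectors coordinatewise *)
Ltac vring := apply: coord_inj => ? /=;
  rewrite ?(linearD, linearN, linearZ, linear0) /= ?regular_scaleE; ring.

(* The complexification V (x) C of a real vector space V; the pair (x, y)
   stands for x + iy. *)
Definition complexification (R : realType) (V : vectType R) : Type :=
  (V * V)%type.

Section Complexification.
Variables (R : realType) (V : vectType R).
Local Notation VC := (complexification V).

HB.instance Definition _ := GRing.Zmodule.copy VC (V * V)%type.

Definition cscale (a : R[i]) (z : VC) : VC :=
  let: a1 +i* a2 := a in (a1 *: z.1 - a2 *: z.2, a1 *: z.2 + a2 *: z.1).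

Fact cscaleA a b z : cscale a (cscale b z) = cscale (a * b) z.
Proof. by case: a b z => [a1 a2] [b1 b2] [x y]; congr pair; vring. Qed.

Fact cscale1 : left_id 1 cscale.
Proof. by case=> x y; congr pair; vring. Qed.

Fact cscaleDr : right_distributive cscale +%R.
Proof. by move=> [a1 a2] [x y] [x' y']; congr pair; vring. Qed.

Fact cscaleDl z : {morph cscale^~ z : a b / a + b}.
Proof. by move=> [a1 a2] [b1 b2]; case: z => x y; congr pair; vring. Qed.

HB.instance Definition _ :=
  GRing.Zmodule_isLmodule.Build R[i] VC cscaleA cscale1 cscaleDr cscaleDl.

Fact complexification_iso : Vector.axiom (\dim {:V}) VC.
Proof.
exists (fun z =>
    \row_j (coord (vbasis {:V}) j z.1 +i* coord (vbasis {:V}) j z.2)).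
  move=> [a1 a2] [x y] [x' y']; apply/rowP=> j; rewrite !mxE /=.
  by apply/eqP; rewrite eq_complex /=; apply/andP; split; apply/eqP;
    rewrite ?(linearD, linearN, linearZ) /= ?regular_scaleE; ring.
exists (fun r : 'rV[R[i]]_(\dim {:V}) =>
   (\sum_j complex.Re (r 0 j) *: (vbasis {:V})`_j,
    \sum_j complex.Im (r 0 j) *: (vbasis {:V})`_j) : VC).
  case=> x y /=; congr pair; rewrite [RHS](coord_vbasis (memvf _)) /=;
    by apply: eq_bigr => j _; rewrite mxE.
move=> r; apply/rowP=> j; rewrite mxE /= !coord_sum_free;
  try exact: basis_free (vbasisP _).
by case: (r 0 j).
Qed.

HB.instance Definition _ :=
  Lmodule_hasFinDim.Build R[i] VC complexification_iso.

Definition toC (x : V) : VC := (x, 0).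

Definition complexify_map (f : 'End(V)) : 'End(VC) :=
  linfun (fun z : VC => (f z.1, f z.2) : VC).

Definition complexify_space (s : {vspace V}) : {vspace VC} :=
  <<[seq toC x | x <- vbasis s]>>%VS.

End Complexification.

Section ComplexLie.
Variables (R : realType) (g : lieAlgType R).
Local Notation gC := (complexification g).

Definition lieC (z w : gC) : gC :=
  (lie z.1 w.1 - lie z.2 w.2, lie z.1 w.2 + lie z.2 w.1).

Fact lieC_linear_l w : linear (lieC^~ w).
Proof.
move=> [a1 a2] [x y] [x' y']; case: w => u v.
congr pair; rewrite /= ?lieE; vring.
Qed.

Fact lieC_linear_r z : linear (lieC z).
Proof.
move=> [a1 a2] [x y] [x' y']; case: z => u v.
congr pair; rewrite /= ?lieE; vring.
Qed.

Fact lieCxx z : lieC z z = 0.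
Proof.
by case: z => x y; congr pair; rewrite /= ?liexx ?(lie_anti y x); vring.
Qed.

Fact jacobiC x y z :
  lieC x (lieC y z) + lieC y (lieC z x) + lieC z (lieC x y) = 0.
Proof.
case: x y z => [x x'] [y y'] [z z'].
have J (a b c : g) : lie c (lie a b) = - lie a (lie b c) - lie b (lie c a).
  by rewrite -[LHS]subr0 -(jacobi a b c); vring.
congr pair; rewrite /= ?lieE.
  by rewrite (J x y z) (J x y' z') (J x' y z') (J x' y' z); vring.
by rewrite (J x y z') (J x y' z) (J x' y z) (J x' y' z'); vring.
Qed.

HB.instance Definition _ := Vector_isLieAlgebra.Build R[i] gC
  lieC_linear_l lieC_linear_r lieCxx jacobiC.

End ComplexLie.

Notation dual_tC t := 'Hom(subvs_of (complexify_space t), (complex _)^o).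

Section Roots.
Variables (R : realType) (g : lieAlgType R) (t : {vspace g}).
Local Notation gC := (complexification g).
Local Notation tC := (complexify_space t).

Definition is_root (a : dual_tC t) :=
  a != 0 /\
  exists2 z : gC, z != 0 &
    forall H : subvs_of tC, lie (vsval H) z = (a H : R[i]) *: z.

Definition simple_roots n (alpha : 'I_n -> dual_tC t) :=
  [/\ forall j, is_root (alpha j),
      free [seq alpha j | j : 'I_n] &
      forall b, is_root b -> exists c : 'I_n -> nat,
        b = \sum_j alpha j *+ c j \/ b = - \sum_j alpha j *+ c j].

(* the highest root is the greatest one for the partial order in which
   b <= d when d - b is a nonnegative integral combination of simple roots *)
Definition highest_root n (alpha : 'I_n -> dual_tC t) (d : dual_tC t) :=
  is_root d /\
  forall b, is_root b -> exists c : 'I_n -> nat, d - b = \sum_j alpha j *+ c j.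

(* Pi(h), meaningful for m i = 3 or m i = 4 only *)
Definition simple_roots_h n (alpha : 'I_n -> dual_tC t) (m : 'I_n -> nat)
    (i : 'I_n) : set (dual_tC t) :=
  let alpha0 := - \sum_j alpha j *+ m j in
  [set b | (m i = 4%N /\ b = alpha0) \/ exists2 j, j != i & b = alpha j].

(* b |-> b \o nu^-1, for nu bijective with nu(t) = t *)
Definition root_action (nu : 'End(g)) (b : dual_tC t) : dual_tC t :=
  (b \o linfun (vsproj tC) \o (complexify_map nu)^-1 \o linfun vsval)%VF.

End Roots.

(* Main.v *)
From HB Require Import structures.
Require Import Defs.
From mathcomp Require Import all_boot all_order all_algebra.
From mathcomp Require Import complex ring lra zify.
From mathcomp Require Import all_classical all_reals all_analysis.

Set Implicit Arguments.
Unset Strict Implicit.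
Unset Printing Implicit Defensive.

Import Order.TTheory GRing.Theory Num.Theory passmx.
Import numFieldNormedType.Exports.
Local Open Scope classical_set_scope.
Local Open Scope ring_scope.
Local Open Scope complex_scope.

(** The proof produces an element A of h that tau fixes and that is regular
    in h, and moves A by an inner automorphism mu of h to the interior of the
    Weyl chamber of t defined by Pi(h). Then nu = mu tau mu^-1 fixes mu A, so it
    preserves the centralizer of mu A in h, which is t, and it preserves the set
    of roots of h that are positive on mu A; an involution of a root system that
    preserves the positive roots permutes the simple ones (base_permuted).

    A regular fixed element exists (involution_fixed_regular): among the elements
    of h fixed by tau, take A with the smallest centralizer in h. Minimality
    makes every tau-fixed element of this centralizer central in it; the bracket
    of two anti-fixed elements is tau-fixed, hence central, hence orthogonal to
    itself for the Killing form. So the centralizer is abelian.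

    The automorphism mu maximizes the scalar product of mu A with a vector T in
    the open chamber of Pi(h) (torus_chamber_conjugacy). The first derivative
    says that mu A commutes with T, which puts it in t; the second derivative
    says that mu A and T are on the same side of all root hyperplanes. This
    replaces both the conjugacy of maximal tori and the transitivity of the Weyl
    group on chambers.

    The maximum exists within Int(h) because Int(h) is compact
    (Int_group_compact). It acts by isometries of a definite form, so it is
    bounded. It is closed because it contains a neighbourhood of 1 in the closed
    group of automorphisms commuting with sigma (Int_group_near1): for an
    automorphism 1 + D, the failure of the Leibniz rule for D is quadratic in D,
    so D is close to a derivation commuting with sigma, that is to ad x with x in
    h, and a Newton step by the exponential of - ad x brings the automorphism
    closer to 1 (exp_newton).

    Finally, the roots of h are the roots b with exp(b(X)) = 1. The coefficient
    of alpha_i in b is at most m_i <= 4 in absolute value, so it is 0 or, when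
    m_i = 4, possibly 4 or -4; subtracting b from the highest root then expresses
    b through alpha_0 and the alpha_j with j <> i (fixed_root_simple_sum). *)

(** * Linear and bilinear maps on spaces of matrices *)

(** This makes matrix spaces complete normed modules, so that absolutely
    convergent series of matrices converge. *)
HB.instance Definition _ (R : realType) m n := Complete.on 'M[R]_(m, n).

Section LinearContinuity.
Variable R : realType.

Lemma mx_norm_coord m n (A : 'M[R]_(m, n)) i j : `|A i j| <= `|A|.
Proof. by rewrite [leRHS]/Num.norm /= mx_normrE; apply: (le_bigmax _ _ (i, j)). Qed.

Lemma mx_norm_le m n (A : 'M[R]_(m, n)) c :
  0 <= c -> (forall i j, `|A i j| <= c) -> `|A| <= c.
Proof.
by move=> c0 Ac; rewrite [leLHS]/Num.norm /= mx_normrE; apply: bigmax_le => // -[].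
Qed.

Lemma linear_mx_bounded m n (W : normedModType R) (f : 'M[R]_(m, n) -> W) :
  linear f -> exists2 C, 0 <= C & forall A, `|f A| <= C * `|A|.
Proof.
move=> f_lin; pose L := GRing.isLinear.Build _ _ _ _ f f_lin.
pose F : {linear 'M[R]_(m, n) -> W} := HB.pack f L.
exists (\sum_i \sum_j `|f (delta_mx i j)|).
  by do 2![apply: sumr_ge0 => ? _].
move=> A; rewrite {1}(matrix_sum_delta A) -[f _]/(F _) linear_sum mulr_suml.
apply: le_trans (ler_norm_sum _ _ _) _; apply: ler_sum => i _.
rewrite linear_sum mulr_suml.
apply: le_trans (ler_norm_sum _ _ _) _; apply: ler_sum => j _.
by rewrite linearZ /= normrZ mulrC ler_wpM2l ?mx_norm_coord.
Qed.

Lemma linear_mx_continuous m n (W : normedModType R) (f : 'M[R]_(m, n) -> W) :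
  linear f -> continuous f.
Proof.
move=> f_lin; have [C C0 fC] := linear_mx_bounded f_lin.
pose L := GRing.isLinear.Build _ _ _ _ f f_lin.
pose F : {linear 'M[R]_(m, n) -> W} := HB.pack f L.
apply/(linear_bounded_continuous F).
exists C; split => //= M CM; near=> A.
apply: le_trans (fC A) _; rewrite -[leRHS]mulr1 ler_pM//; first exact: ltW.
Unshelve. all: by end_near. Qed.

Lemma bilinear_mx_bounded m n p q (W : normedModType R)
    (f : 'M[R]_(m, n) -> 'M[R]_(p, q) -> W) :
  (forall B, linear (f^~ B)) -> (forall A, linear (f A)) ->
  exists2 C, 0 <= C & forall A B, `|f A B| <= C * (`|A| * `|B|).
Proof.
move=> fl fr.
have Cex (k : 'I_m * 'I_n) :
    exists C, 0 <= C /\ forall B, `|f (delta_mx k.1 k.2) B| <= C * `|B|.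
  by have [C] := linear_mx_bounded (fr (delta_mx k.1 k.2)); exists C.
have [C Cp] := choice Cex.
exists (\sum_i \sum_j C (i, j)).
  by apply: sumr_ge0 => i _; apply: sumr_ge0 => j _; case: (Cp (i, j)).
move=> A B; pose L := GRing.isLinear.Build _ _ _ _ (f^~ B) (fl B).
pose F : {linear 'M[R]_(m, n) -> W} := HB.pack (f^~ B) L.
rewrite {1}(matrix_sum_delta A) -[f _ _]/(F _) linear_sum mulr_suml.
apply: le_trans (ler_norm_sum _ _ _) _; apply: ler_sum => i _.
rewrite linear_sum mulr_suml.
apply: le_trans (ler_norm_sum _ _ _) _; apply: ler_sum => j _.
rewrite linearZ /= normrZ mulrCA ler_pM ?mx_norm_coord //.
by case: (Cp (i, j)).
Qed.

Lemma mx_bounded_closed_compact m n (A : set 'M[R]_(m, n)) c :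
  (forall M, A M -> `|M| <= c) -> closed A -> compact A.
Proof.
move=> A_bnd A_cl.
pose B : set 'rV[R]_(m * n) := vec_mx @^-1` A.
have vec_cont : continuous (@vec_mx R m n).
  by apply: linear_mx_continuous => a u v; rewrite linearP.
have <- : vec_mx @` B = A.
  apply/seteqP; split=> [_ [v Bv <-] //|M AM]; exists (mxvec M); last exact: mxvecK.
  by rewrite /B /= mxvecK.
apply: continuous_compact; first exact: continuous_subspaceT.
apply: bounded_closed_compact; last by apply: preimage_closed A_cl => v _; exact: vec_cont.
exists c; split; first exact: num_real.
move=> c' cc' v /A_bnd vc.
have c'0 : 0 <= c' by rewrite (le_trans _ (ltW cc')) // (le_trans _ vc).
apply: mx_norm_le => // i k; rewrite ord1.
rewrite -[v]vec_mxK; case/mxvec_indexP: k => k l; rewrite mxvecE.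
by apply: le_trans (mx_norm_coord _ _ _) _; apply: le_trans vc (ltW cc').
Qed.

End LinearContinuity.

(** * The matrix exponential *)

(** The factor d makes the entrywise sup norm submultiplicative. *)
HB.lock Definition nrm (R : realType) d (A : 'M[R]_d) : R := d%:R * `|A|.

Section MatrixExponential.
Variables (R : realType) (d : nat).
Implicit Types A B P : 'M[R]_d.
Local Notation nrm := (@nrm R d).

Lemma nrm_ge0 A : 0 <= nrm A. Proof. by rewrite nrm.unlock mulr_ge0. Qed.
Hint Resolve nrm_ge0 : core.

Lemma norm_le_nrm A : `|A| <= nrm A.
Proof.
have [d0|d_gt0] := posnP d; last by rewrite nrm.unlock ler_peMl// ler1n.
rewrite (_ : A = 0) ?normr0 ?nrm_ge0//.
by apply/matrixP => -[i i_lt]; exfalso; rewrite d0 in i_lt.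
Qed.

Lemma nrm0 : nrm 0 = 0. Proof. by rewrite nrm.unlock normr0 mulr0. Qed.

Lemma nrm_eq0 A : nrm A = 0 -> A = 0.
Proof.
rewrite nrm.unlock => /eqP; rewrite mulf_eq0 pnatr_eq0 => /orP[/eqP d0|/eqP/normr0_eq0//].
by apply/matrixP => -[i i_lt]; exfalso; rewrite d0 in i_lt.
Qed.

Lemma nrmN A : nrm (- A) = nrm A. Proof. by rewrite nrm.unlock normrN. Qed.

Lemma nrmD A B : nrm (A + B) <= nrm A + nrm B.
Proof. by rewrite nrm.unlock -mulrDr ler_wpM2l// ler_normD. Qed.

Lemma nrmB A B : nrm (A - B) <= nrm A + nrm B.
Proof. by rewrite -(nrmN B) nrmD. Qed.

Lemma nrmZ a A : nrm (a *: A) = `|a| * nrm A.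
Proof. by rewrite nrm.unlock normrZ mulrCA. Qed.

Lemma nrm_sum I (r : seq I) (P : pred I) (F : I -> 'M[R]_d) :
  nrm (\sum_(i <- r | P i) F i) <= \sum_(i <- r | P i) nrm (F i).
Proof.
elim/big_ind2: _ => [|A a B b Aa Bb|//]; first by rewrite nrm0.
by apply: le_trans (nrmD _ _) _; apply: lerD.
Qed.

Lemma nrmM A B : nrm (A *m B) <= nrm A * nrm B.
Proof.
rewrite nrm.unlock -mulrA ler_wpM2l// mulrCA; apply: mx_norm_le => [|i j].
  by rewrite !mulr_ge0.
rewrite mxE; apply: le_trans (ler_norm_sum _ _ _) _.
rewrite mulr_natl -[X in _ *+ X]card_ord -sumr_const.
apply: ler_sum => k _.
by rewrite normrM ler_pM// mx_norm_coord.
Qed.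

Lemma nrm1 : nrm 1 <= d%:R.
Proof.
rewrite nrm.unlock ler_piMr// mx_norm_le// => i j.
by rewrite mxE; case: eqP => _; rewrite ?normr1 ?normr0.
Qed.

Lemma nrm_expr A k : nrm (A ^+ k) <= d.+1%:R * nrm A ^+ k.
Proof.
elim: k => [|k IHk].
  by rewrite !expr0 mulr1 (le_trans nrm1)// ler_nat.
rewrite !exprS mulrCA; apply: le_trans (nrmM _ _) _.
by rewrite ler_wpM2l.
Qed.

Lemma nrm_exprS A k : nrm (A ^+ k.+1) <= nrm A ^+ k.+1.
Proof.
elim: k => [|k IHk]; first by rewrite !expr1.
rewrite exprS [leRHS]exprS; apply: le_trans (nrmM _ _) _.
by rewrite ler_wpM2l.
Qed.

Lemma exp_term_le A c k : nrm A <= c ->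
  `|(k`!%:R^-1 : R) *: A ^+ k| <= d.+1%:R * exp_coeff c k.
Proof.
move=> Ac; apply: le_trans (norm_le_nrm _) _; rewrite nrmZ ger0_norm ?invr_ge0//.
rewrite /exp_coeff /= mulrC mulrA ler_wpM2r ?invr_ge0//.
apply: le_trans (nrm_expr _ _) _; rewrite ler_wpM2l// lerXn2r ?nnegrE ?nrm_ge0//.
exact: le_trans (nrm_ge0 A) Ac.
Qed.

Definition expsum A N : 'M[R]_d := \sum_(0 <= k < N) (k`!%:R^-1 : R) *: A ^+ k.

Lemma expsum_cvg A : expsum A @ \oo --> expmx A.
Proof.
suff: cvgn (expsum A) by [].
apply: normed_cvg.
apply: (@series_le_cvg _ _ (fun k => d.+1%:R * exp_coeff (nrm A) k)) => [k|k|k|] /=.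
- exact: normr_ge0.
- by rewrite mulr_ge0// exp_coeff_ge0.
- exact: exp_term_le.
exact: is_cvg_seriesZ (is_cvg_series_exp_coeff (nrm A)).
Qed.

Lemma nrm_continuous : continuous nrm.
Proof.
move=> A; rewrite nrm.unlock.
have cd : (fun=> d%:R : R) @ nbhs A --> (d%:R : R) by exact: cvg_cst.
exact: cvgM cd (@norm_continuous _ _ A).
Qed.

Lemma nrm_limit_le (u : nat -> 'M[R]_d) A B c N0 :
  u @ \oo --> A -> (forall N, nrm (u (N + N0)%N - B) <= c) -> nrm (A - B) <= c.
Proof.
move=> uA u_le.
have uB : (fun N => nrm (u N - B)) @ \oo --> nrm (A - B).
  apply: (@continuous_cvg _ _ _ \oo _ (fun N => u N - B) nrm); first exact: nrm_continuous.
  by apply: cvgB => //; exact: cvg_cst.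
rewrite -(cvg_lim _ uB)//; apply: limr_le; first by apply/cvg_ex; exists (nrm (A - B)).
exists N0 => // N /= N0N; by rewrite -(subnK N0N).
Qed.

Lemma sum_inv_fact_le N : \sum_(0 <= k < N) (k`!%:R^-1 : R) <= expR 1.
Proof.
have := @nondecreasing_cvgn_le R (series (exp_coeff 1)) _ _ N.
rewrite /expR /series /= (eq_bigr (fun k => k`!%:R^-1)) => [|k _].
  apply; last exact: is_cvg_series_exp_coeff.
  apply/nondecreasing_seqP => k; rewrite /series /= big_nat_recr//= lerDl.
  exact: exp_coeff_ge0.
by rewrite /exp_coeff /= expr1n mul1r.
Qed.

Lemma inv_fact_le k j : ((k + j)`!%:R^-1 : R) <= k`!%:R^-1.
Proof.
rewrite lef_pV2 ?posrE ?ltr0n ?fact_gt0// ler_nat.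
elim: j => [|j IHj]; first by rewrite addn0.
by rewrite addnS factS (leq_trans IHj)// leq_pmull.
Qed.

Lemma nrm_subX A B m k : nrm A <= m -> nrm B <= m ->
  nrm (A ^+ k.+1 - B ^+ k.+1) <= k.+1%:R * m ^+ k * nrm (A - B).
Proof.
move=> Am Bm; have m0 : 0 <= m by exact: le_trans Am.
elim: k => [|k IHk]; first by rewrite !expr1 expr0 !mul1r.
have -> : A ^+ k.+2 - B ^+ k.+2 =
    A *m (A ^+ k.+1 - B ^+ k.+1) + (A - B) *m B ^+ k.+1.
  by rewrite (exprS A) (exprS B) mulmxBr mulmxBl addrA subrK.
apply: le_trans (nrmD _ _) _.
rewrite -(addn1 k.+1) natrD !mulrDl mul1r; apply: lerD.
  apply: le_trans (nrmM _ _) _.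
  rewrite (_ : k.+1%:R * m ^+ k.+1 * nrm (A - B) =
    m * (k.+1%:R * m ^+ k * nrm (A - B))); first by rewrite ler_pM.
  by rewrite [m ^+ k.+1]exprS; ring.
apply: le_trans (nrmM _ _) _; rewrite mulrC ler_wpM2r//.
apply: le_trans (nrm_exprS _ _) _.
by rewrite lerXn2r ?nnegrE.
Qed.

(** Term by term, A^k - B^k is at most k m^(k-1) times A - B in norm. This
    uniform control of the nonlinear part makes Newton steps contract. *)
Lemma expmx_sub_le A B m : nrm A <= m -> nrm B <= m -> m <= 1 ->
  nrm (expmx A - expmx B - (A - B)) <= expR 1 * m * nrm (A - B).
Proof.
move=> Am Bm m1; have m0 : 0 <= m by exact: le_trans Am.
apply: (@nrm_limit_le (fun N => expsum A N - expsum B N) _ _ _ 2).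
  by apply: cvgB; exact: expsum_cvg.
move=> N; rewrite addn2 /expsum -sumrB !big_nat_recl// !expr0 !expr1 subrr add0r.
rewrite -scalerBr invr1 scale1r addrC addKr.
apply: le_trans (nrm_sum _ _ _) _.
rewrite -mulrA; apply: le_trans (ler_wpM2r _ (sum_inv_fact_le N)); last first.
  by rewrite mulr_ge0.
rewrite mulr_suml; apply: ler_sum => k _.
rewrite -scalerBr nrmZ ger0_norm ?invr_ge0//.
have := nrm_subX k.+1 Am Bm.
move=> /(ler_wpM2l (_ : 0 <= k.+2`!%:R^-1 :> R)).
rewrite invr_ge0 ler0n => /(_ isT)/le_trans; apply.
rewrite !mulrA ler_wpM2r//.
have -> : k.+2`!%:R^-1 * k.+2%:R = k.+1`!%:R^-1 :> R.
  by rewrite factS natrM invfM mulrAC mulVf ?pnatr_eq0// mul1r.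
have := inv_fact_le k 1; rewrite addn1 => kk.
by rewrite ler_pM ?invr_ge0 ?exprn_ge0// exprS ler_piMr// exprn_ile1.
Qed.

Lemma expmx_order3_le A : nrm A <= 1 ->
  nrm (expmx A - (1 + A + 2^-1 *: (A *m A))) <= expR 1 * nrm A ^+ 3.
Proof.
move=> A1; apply: (@nrm_limit_le (expsum A) _ _ _ 3 (@expsum_cvg A)) => N.
rewrite addn3 /expsum !big_nat_recl// !expr0 !expr1 expr2 invr1 !scale1r.
rewrite !addrA -[A * A]/(A *m A) -[2`!]/2%N [X in nrm X <= _]addrAC subrr add0r.
apply: le_trans (nrm_sum _ _ _) _.
apply: le_trans (ler_wpM2r _ (sum_inv_fact_le N)); last exact: exprn_ge0.
rewrite mulr_suml; apply: ler_sum => k _.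
rewrite nrmZ ger0_norm ?invr_ge0//.
have := inv_fact_le k 3; rewrite addn3 => kk.
rewrite ler_pM ?invr_ge0//; apply: le_trans (nrm_exprS _ _) _.
by rewrite -addn3 exprD ler_piMl ?exprn_ge0// exprn_ile1.
Qed.

Lemma expmx0 : expmx (0 : 'M[R]_d) = 1.
Proof.
apply/eqP; rewrite -subr_eq0; apply/eqP/nrm_eq0/eqP.
rewrite eq_le nrm_ge0 andbT.
have := @expmx_order3_le 0; rewrite nrm0 ler01 => /(_ isT).
by rewrite mul0mx scaler0 !addr0 expr0n mulr0.
Qed.

Lemma linear_expmx_cvg (W : normedModType R) (f : 'M[R]_d -> W) A :
  linear f ->
  (fun N => \sum_(0 <= k < N) (k`!%:R^-1 : R) *: f (A ^+ k)) @ \oo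
    --> f (expmx A).
Proof.
move=> f_lin.
pose L := GRing.isLinear.Build _ _ _ _ f f_lin.
pose F : {linear 'M[R]_d -> W} := HB.pack f L.
rewrite (_ : (fun N => _) = f \o expsum A); last first.
  apply/funext => N /=; rewrite -[f _]/(F _) linear_sum.
  by apply: eq_bigr => k _; rewrite linearZ.
exact: (cvg_comp _ _ (@expsum_cvg A) (linear_mx_continuous f_lin (x := _))).
Qed.

Lemma expmx_intertwine A B P : A *m P = P *m B -> expmx A *m P = P *m expmx B.
Proof.
move=> APB.
have APBk k : A ^+ k *m P = P *m B ^+ k.
  elim: k => [|k IHk]; first by rewrite !expr0 mul1mx mulmx1.
  rewrite (exprSr A) (exprSr B) -[A ^+ k * A]/(A ^+ k *m A).
  by rewrite -[B ^+ k * B]/(B ^+ k *m B) mulmxA -IHk -!mulmxA APB.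
have lA : linear (fun M : 'M[R]_d => M *m P) by move=> a u v; rewrite mulmxDl scalemxAl.
have lB : linear (fun M : 'M[R]_d => P *m M) by move=> a u v; rewrite mulmxDr scalemxAr.
have := linear_expmx_cvg (A := A) lA; have := linear_expmx_cvg (A := B) lB.
under eq_fun do under eq_bigr do rewrite -APBk.
by move=> cB cA; rewrite -(cvg_lim _ cA)// -(cvg_lim _ cB).
Qed.

End MatrixExponential.

(** * Cauchy products of exponential series *)

Section ExponentialProduct.
Variable R : realType.

Lemma triangle_sum (V : zmodType) (F : nat -> nat -> V) N :
  \sum_(0 <= k < N) \sum_(0 <= i < k.+1) F i (k - i)%N =
  \sum_(0 <= i < N) \sum_(0 <= j < N | (i + j < N)%N) F i j.
Proof.
transitivity (\sum_(0 <= k < N) \sum_(0 <= i < N | (i <= k)%N) F i (k - i)%N).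
  rewrite big_nat [RHS]big_nat; apply: eq_bigr => k /andP[_ kN].
  by rewrite (big_nat_widen _ _ N).
rewrite (exchange_big_dep_nat predT)//=.
rewrite big_nat [RHS]big_nat; apply: eq_bigr => i /andP[_ iN].
rewrite -(big_nat_widenl i 0 N predT)//.
rewrite -[X in \sum_(X <= _ < _) _]add0n big_addn.
rewrite (big_nat_widen _ _ N) ?leq_subr//=.
apply: eq_big => [j|j _]; first by rewrite ltn_subRL.
by rewrite addnK.
Qed.

Lemma exp_coeff_convolution (c : R) k :
  \sum_(0 <= i < k.+1) exp_coeff c i * exp_coeff c (k - i)%N = exp_coeff (c + c) k.
Proof.
rewrite /exp_coeff /= exprDn big_mkord mulr_suml; apply: eq_bigr => i _.
have ik : (i <= k)%N by rewrite -ltnS.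
rewrite -(bin_fact ik) -mulr_natr !natrM.
have fi := fact_gt0 i; have fk := fact_gt0 (k - i)%N.
have bi : (0 < 'C(k, i))%N by rewrite bin_gt0.
set u := c ^+ (k - i); set v := c ^+ i.
by field; rewrite !pnatr_eq0 -!lt0n fi fk bi.
Qed.

(** The sum of q over a square of indices minus the sum over the triangle is at
    most the same difference for the scalar series, which tends to
    exp(c)^2 - exp(2c) = 0. *)
Lemma expmx_bilinear d (q : 'M[R]_d -> 'M[R]_d -> R^o) (l : 'M[R]_d -> R^o) A B C :
  (forall Y, linear (q^~ Y)) -> (forall X, linear (q X)) -> linear l ->
  (forall k, l (C ^+ k) =
     \sum_(0 <= i < k.+1) 'C(k, i)%:R * q (A ^+ i) (B ^+ (k - i)%N)) ->
  l (expmx C) = q (expmx A) (expmx B).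
Proof.
move=> ql qr l_lin leibniz.
have [D0 D00 qD0] := bilinear_mx_bounded ql qr.
pose D : R := D0; have D0_ge0 : 0 <= D := D00.
have qD X Y : `|q X Y| <= D * (`|X| * `|Y|) by exact: qD0.
pose c := nrm A + nrm B.
have dA i : `|(i`!%:R^-1 : R) *: A ^+ i| <= d.+1%:R * exp_coeff c i.
  by apply: exp_term_le; rewrite lerDl nrm_ge0.
have dB i : `|(i`!%:R^-1 : R) *: B ^+ i| <= d.+1%:R * exp_coeff c i.
  by apply: exp_term_le; rewrite lerDr nrm_ge0.
pose F i j := q ((i`!%:R^-1 : R) *: A ^+ i) ((j`!%:R^-1 : R) *: B ^+ j).
pose M : R := D * (d.+1%:R * d.+1%:R).
have M0 : 0 <= M by rewrite !mulr_ge0.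
have FM i j : `|F i j| <= M * (exp_coeff c i * exp_coeff c j).
  apply: le_trans (qD _ _) _; rewrite -mulrA ler_wpM2l// mulrACA.
  by rewrite ler_pM.
have qsuml N Y : q (expsum A N) Y = \sum_(0 <= i < N) q ((i`!%:R^-1 : R) *: A ^+ i) Y.
  pose L := GRing.isLinear.Build _ _ _ _ (q^~ Y) (ql Y).
  pose Q : {linear 'M[R]_d -> R^o} := HB.pack (q^~ Y) L.
  by rewrite -[q _ _]/(Q _) linear_sum.
have qsumr N X : q X (expsum B N) = \sum_(0 <= i < N) q X ((i`!%:R^-1 : R) *: B ^+ i).
  pose L := GRing.isLinear.Build _ _ _ _ (q X) (qr X).
  pose Q : {linear 'M[R]_d -> R^o} := HB.pack (q X) L.
  by rewrite -[q _ _]/(Q _) linear_sum.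
pose P N : R := q (expsum A N) (expsum B N).
have PE N : P N = \sum_(0 <= i < N) \sum_(0 <= j < N) F i j.
  by rewrite /P qsuml; apply: eq_bigr => i _; rewrite qsumr.
pose S N : R := \sum_(0 <= k < N) (k`!%:R^-1 : R) *: l (C ^+ k).
have SE N : S N = \sum_(0 <= i < N) \sum_(0 <= j < N | (i + j < N)%N) F i j.
  rewrite -triangle_sum; apply: eq_bigr => k _.
  rewrite leibniz regular_scaleE mulr_sumr big_nat [RHS]big_nat.
  apply: eq_bigr => i /andP[_ ik].
  pose L := GRing.isLinear.Build _ _ _ _ (q (A ^+ i)) (qr (A ^+ i)).
  pose Q : {linear 'M[R]_d -> R^o} := HB.pack (q (A ^+ i)) L.
  pose Y := (k - i)`!%:R^-1 *: B ^+ (k - i).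
  pose L' := GRing.isLinear.Build _ _ _ _ (q^~ Y) (ql Y).
  pose Q' : {linear 'M[R]_d -> R^o} := HB.pack (q^~ Y) L'.
  rewrite /F -[q _ _ in RHS]/(Q' _) linearZ /= -[q _ Y]/(Q Y) linearZ /=.
  rewrite !regular_scaleE !mulrA; congr (_ * _).
  rewrite -(bin_fact (ik : (i <= k)%N)) !natrM !invfM.
  have bi : (0 < 'C(k, i))%N by rewrite bin_gt0.
  by rewrite mulrAC mulVf ?pnatr_eq0 -?lt0n// mul1r.
have PS N : `|P N - S N| <= M * (series (exp_coeff c) N * series (exp_coeff c) N
                                 - series (exp_coeff (c + c)) N).
  have -> : P N - S N = \sum_(0 <= i < N) \sum_(0 <= j < N | ~~ (i + j < N)%N) F i j.
    rewrite PE SE -sumrB; apply: eq_bigr => i _.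
    by rewrite (bigID (fun j => i + j < N)%N) /= addrAC subrr add0r.
  have -> : series (exp_coeff c) N * series (exp_coeff c) N
            - series (exp_coeff (c + c)) N =
      \sum_(0 <= i < N) \sum_(0 <= j < N | ~~ (i + j < N)%N)
        exp_coeff c i * exp_coeff c j.
    have -> : series (exp_coeff (c + c)) N =
        \sum_(0 <= i < N) \sum_(0 <= j < N | (i + j < N)%N)
          exp_coeff c i * exp_coeff c j.
      rewrite -triangle_sum; apply: eq_bigr => k _.
      by rewrite exp_coeff_convolution.
    rewrite {1}/series /= mulr_suml -sumrB; apply: eq_bigr => i _.
    rewrite /series /= mulr_sumr.
    by rewrite (bigID (fun j => i + j < N)%N) /= addrAC subrr add0r.
  rewrite mulr_sumr; apply: le_trans (ler_norm_sum _ _ _) _; apply: ler_sum => i _.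
  rewrite mulr_sumr; apply: le_trans (ler_norm_sum _ _ _) _; apply: ler_sum => j _.
  exact: FM.
pose X := expmx A; pose Y := expmx B; pose Z := expmx C.
have Sl : S @ \oo --> l Z by exact: linear_expmx_cvg.
have Pq N : `|P N - q X Y| <=
    D * (`|expsum A N - X| * `|expsum B N|) + D * (`|X| * `|expsum B N - Y|).
  have -> : P N - q X Y = q (expsum A N - X) (expsum B N) + q X (expsum B N - Y).
    pose L := GRing.isLinear.Build _ _ _ _ (q X) (qr X).
    pose Q : {linear 'M[R]_d -> R^o} := HB.pack (q X) L.
    pose L' := GRing.isLinear.Build _ _ _ _ (q^~ (expsum B N)) (ql (expsum B N)).
    pose Q' : {linear 'M[R]_d -> R^o} := HB.pack (q^~ (expsum B N)) L'.
    rewrite -[q (_ - _) _]/(Q' _) -[q X (_ - _)]/(Q _) !linearB /=.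
    by rewrite /P addrA subrK.
  by apply: le_trans (ler_normD _ _) _; apply: lerD.
apply/eqP; rewrite -subr_eq0 -normr_eq0 eq_le normr_ge0 andbT.
pose bnd N := `|S N - l Z| + M * (series (exp_coeff c) N * series (exp_coeff c) N
    - series (exp_coeff (c + c)) N)
  + (D * (`|expsum A N - X| * `|expsum B N|) + D * (`|X| * `|expsum B N - Y|)).
have cvg0 (V : normedModType R) (u : nat -> V) v :
    u @ \oo --> v -> (fun N => `|u N - v|) @ \oo --> (0 : R).
  move=> uv; rewrite -(@normr0 _ V) -(subrr v).
  by apply: cvg_norm; apply: cvgB => //; exact: cvg_cst.
have bnd0 : bnd @ \oo --> (0 : R).
  rewrite (_ : 0 = 0 + M * (expR c * expR c - expR (c + c))
                   + (D * (0 * `|Y|) + D * (`|X| * 0)) :> R); last first.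
    by rewrite expRD subrr !(mulr0, mul0r, addr0).
  have cE (x : R) : series (exp_coeff x) @ \oo --> expR x.
    exact: is_cvg_series_exp_coeff.
  have cc (x : R) : (fun=> x) @ \oo --> x by exact: cvg_cst.
  have cS : (fun N => `|S N - l Z| : R) @ \oo --> (0 : R) by exact: cvg0 Sl.
  have cA : (fun N => `|expsum A N - X| : R) @ \oo --> (0 : R).
    by apply: cvg0; exact: expsum_cvg.
  have cB : (fun N => `|expsum B N - Y| : R) @ \oo --> (0 : R).
    by apply: cvg0; exact: expsum_cvg.
  have nB : (fun N => `|expsum B N| : R) @ \oo --> (`|Y| : R).
    by apply: cvg_norm; exact: expsum_cvg.
  have cM : (fun N => M * (series (exp_coeff c) N * series (exp_coeff c) N
      - series (exp_coeff (c + c)) N)) @ \oo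
      --> M * (expR c * expR c - expR (c + c)).
    exact: (cvgM (cc M) (cvgB (cvgM (cE c) (cE c)) (cE (c + c)))).
  have cD : (fun N => D * (`|expsum A N - X| * `|expsum B N|)
      + D * (`|X| * `|expsum B N - Y|)) @ \oo
      --> D * (0 * `|Y|) + D * (`|X| * 0).
    exact: (cvgD (cvgM (cc D) (cvgM cA nB)) (cvgM (cc D) (cvgM (cc `|X|) cB))).
  exact: (cvgD (cvgD cS cM) cD).
apply: (ler_cvg_to (@cvg_cst _ _ _ \oo _) bnd0).
apply: nearW => N.
have -> : l Z - q X Y = - (S N - l Z) - (P N - S N) + (P N - q X Y) by ring.
apply: le_trans (ler_normD _ _) _; apply: lerD => //.
apply: le_trans (ler_normD _ _) _; rewrite !normrN; apply: lerD => //.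
Qed.

Lemma expmx_opp d (A : 'M[R]_d) : expmx (- A) *m expmx A = 1.
Proof.
rewrite -(expmx0 R d); apply/matrixP => i j; apply/esym.
pose q (X Y : 'M[R]_d) : R^o := (Y *m X) i j.
pose l (X : 'M[R]_d) : R^o := X i j.
apply: (@expmx_bilinear _ q l) => [Y a U V|X a U V|a U V|k].
- by rewrite /q mulmxDr -scalemxAr !mxE.
- by rewrite /q mulmxDl -scalemxAl !mxE.
- by rewrite /l !mxE.
rewrite -(addNr A) exprDn_comm; last exact/commr_sym/commrN.
rewrite /l summxE big_mkord; apply: eq_bigr => u _.
by rewrite mulmxnE /q [RHS]mulr_natl.
Qed.

End ExponentialProduct.

(** * The Killing form, automorphisms and derivations *)

Section KillingForm.
Variables (K : fieldType) (g : lieAlgType K).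
Implicit Types (x y z : g) (f : 'End(g)).
Local Notation e := (vbasis {:g}).
Local Notation Mx := (mxof e e).

Let eP : basis_of {:g} e := vbasisP _.

Lemma adE x y : ad x y = lie x y. Proof. by rewrite lfunE. Qed.

Lemma ad_linear : linear (@ad K g).
Proof. by move=> a x y; apply/lfunP => z; rewrite add_lfunE scale_lfunE !adE lieDl lieZl. Qed.

Lemma ad_lie x y : ad (lie x y) = ((ad x \o ad y) - (ad y \o ad x))%VF.
Proof.
apply/lfunP => z; rewrite add_lfunE opp_lfunE !comp_lfunE !adE.
have := jacobi x y z; rewrite (lie_anti z (lie x y)) (lie_anti z x) lieNr.
by move=> /eqP; rewrite subr_eq0 => /eqP ->.
Qed.

Lemma trace_end_linear : linear (@trace_end K g : 'End(g) -> K^o).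
Proof. by move=> a f1 f2; rewrite /trace_end linearP mxtraceD mxtraceZ. Qed.

Lemma trace_endB f1 f2 : trace_end (f1 - f2) = trace_end f1 - trace_end f2.
Proof. by rewrite addrC -scaleN1r trace_end_linear scaleN1r addrC. Qed.

Lemma trace_endC f1 f2 : trace_end (f1 \o f2)%VF = trace_end (f2 \o f1)%VF.
Proof. by rewrite /trace_end !(mxof_comp e e eP) mxtrace_mulC. Qed.

Lemma killingC x y : killing x y = killing y x.
Proof. exact: trace_endC. Qed.

Lemma killing_linear_r x : linear (killing x : g -> K^o).
Proof.
move=> a y z; rewrite /killing ad_linear comp_lfunDr -comp_lfunZr.
exact: trace_end_linear.
Qed.

Lemma killingDr x y z : killing x (y + z) = killing x y + killing x z.
Proof. by have := killing_linear_r x 1 y z; rewrite !scale1r. Qed.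

Lemma killing0r x : killing x 0 = 0.
Proof. by apply: (addrI (killing x 0)); rewrite -killingDr !addr0. Qed.

Lemma killingZr x a y : killing x (a *: y) = a * killing x y.
Proof. by have := killing_linear_r x a y 0; rewrite killing0r !addr0. Qed.

Lemma killingNr x y : killing x (- y) = - killing x y.
Proof. by rewrite -scaleN1r killingZr mulN1r. Qed.

Lemma killingDl x y z : killing (x + y) z = killing x z + killing y z.
Proof. by rewrite !(killingC _ z) killingDr. Qed.

Lemma killingZl x a y : killing (a *: x) y = a * killing x y.
Proof. by rewrite !(killingC _ y) killingZr. Qed.

Lemma killingNl x y : killing (- x) y = - killing x y.
Proof. by rewrite !(killingC _ y) killingNr. Qed.

Lemma killing0l x : killing 0 x = 0.
Proof. by rewrite killingC killing0r. Qed.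

Definition killingE := (killingDl, killingDr, killingNl, killingNr,
  killingZl, killingZr, killing0l, killing0r).

Lemma killing_invariant x y z : killing (lie z x) y = - killing x (lie z y).
Proof.
rewrite /killing !ad_lie comp_lfunDl comp_lfunDr comp_lfunNl comp_lfunNr.
rewrite !trace_endB opprB !comp_lfunA; congr (_ - _).
by rewrite -(comp_lfunA (ad z)) trace_endC.
Qed.

Definition derivation f := forall x y, f (lie x y) = lie (f x) y + lie x (f y).

Lemma derivation_ad x : derivation (ad x).
Proof.
move=> y z; rewrite !adE; have := congr1 (fun f : 'End(g) => f z) (ad_lie x y).
by rewrite add_lfunE opp_lfunE !comp_lfunE !adE => ->; rewrite subrK.
Qed.

Lemma lie_jacobi x y z : lie x (lie y z) = lie (lie x y) z + lie y (lie x z).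
Proof. by have := derivation_ad x y z; rewrite !adE. Qed.

Lemma lie0l x : lie 0 x = 0 :> g.
Proof. by rewrite -[X in lie X _](scale0r x) lieZl scale0r. Qed.

Lemma lie0r x : lie x 0 = 0 :> g. Proof. exact: linear0. Qed.

Lemma lie_comm x y z : lie x y = 0 -> lie x (lie y z) = lie y (lie x z).
Proof. by move=> xy; rewrite lie_jacobi xy lie0l add0r. Qed.

Lemma derivation_ad_bracket f x : derivation f -> ((f \o ad x) - (ad x \o f))%VF = ad (f x).
Proof.
move=> fD; apply/lfunP => y.
by rewrite add_lfunE opp_lfunE !comp_lfunE !adE fD addrK.
Qed.

Lemma automorphismK f : lie_automorphism f -> cancel f f^-1%VF.
Proof. by case=> /eqP f0 _; exact: lker0_lfunK. Qed.

Lemma automorphismVK f : lie_automorphism f -> cancel f^-1%VF f.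
Proof. by case=> /eqP f0 _; exact: lker0_lfunVK. Qed.

Lemma automorphism_of_cancel f f' :
  cancel f f' -> (forall x y, f (lie x y) = lie (f x) (f y)) -> lie_automorphism f.
Proof. by move=> fK fM; split=> //; apply/eqP/lker0P; exact: can_inj fK. Qed.

Lemma automorphism_inv f : lie_automorphism f -> lie_automorphism f^-1%VF.
Proof.
move=> fA; have fK := automorphismK fA; have fVK := automorphismVK fA.
apply: (automorphism_of_cancel fVK) => x y; apply: (can_inj fK).
by rewrite fVK (proj2 fA) !fVK.
Qed.

Lemma automorphism_comp f1 f2 :
  lie_automorphism f1 -> lie_automorphism f2 -> lie_automorphism (f1 \o f2)%VF.
Proof.
move=> A1 A2; apply: (@automorphism_of_cancel _ (f2^-1 \o f1^-1)%VF) => [x|x y].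
  by rewrite !comp_lfunE (automorphismK A1) (automorphismK A2).
by rewrite !comp_lfunE (proj2 A2) (proj2 A1).
Qed.

Lemma automorphism_id : lie_automorphism (\1%VF : 'End(g)).
Proof. by apply: (@automorphism_of_cancel _ \1%VF) => [x|x y]; rewrite !id_lfunE. Qed.

Lemma automorphism_ad f x : lie_automorphism f -> ad (f x) = (f \o ad x \o f^-1)%VF.
Proof.
move=> fA; apply/lfunP => y.
by rewrite !comp_lfunE !adE (proj2 fA) (automorphismVK fA).
Qed.

Lemma killing_automorphism f x y : lie_automorphism f -> killing (f x) (f y) = killing x y.
Proof.
move=> fA; rewrite /killing.
have -> : (ad (f x) \o ad (f y))%VF = (f \o (ad x \o ad y \o f^-1))%VF.
  by apply/lfunP => z; rewrite !(automorphism_ad _ fA) !comp_lfunE (automorphismK fA).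
rewrite (trace_endC f); congr trace_end.
by apply/lfunP => z; rewrite !comp_lfunE (automorphismK fA).
Qed.

End KillingForm.

(** * Compact Lie algebras *)

Section Compact.
Variables (R : realType) (g : lieAlgType R).
Implicit Types (x y z : g) (f : 'End(g)).
Hypothesis g_compact : compact_lie g.

Lemma killing_le0 x : killing x x <= 0.
Proof.
by have [->|/g_compact/ltW//] := eqVneq x 0; rewrite killing0l.
Qed.

Lemma killing_eq0 x : killing x x = 0 -> x = 0.
Proof.
by have [//|/g_compact] := eqVneq x 0; rewrite lt_neqAle => /andP[/eqP].
Qed.

Lemma killing_lie_self x z : killing (lie z x) x = 0.
Proof. by have := killing_invariant x x z; rewrite (killingC x); lra. Qed.

(** ad z is skew for a definite form, hence semisimple. *)
Lemma lie_lie_eq0 z x : lie z (lie z x) = 0 -> lie z x = 0.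
Proof.
by move=> zzx; apply: killing_eq0; rewrite killing_invariant zzx killing0r oppr0.
Qed.

(** The Killing form is nondegenerate, so it identifies g with its dual. *)
Lemma killing_represents (l : g -> R^o) :
  linear l -> exists x, forall y, killing x y = l y.
Proof.
move=> l_lin.
pose kap x : 'Hom(g, R^o) := linfun (killing x : g -> R^o).
have kapE x y : kap x y = killing x y.
  pose L := GRing.isLinear.Build _ _ _ _ _ (killing_linear_r x).
  pose F : {linear g -> R^o} := HB.pack (killing x : g -> R^o) L.
  by rewrite /kap -[killing x : g -> R^o]/(F : g -> R^o) lfunE.
have kap_lin : linear kap.
  by move=> a x y; apply/lfunP => z; rewrite add_lfunE scale_lfunE !kapE !killingE.
pose L := GRing.isLinear.Build _ _ _ _ kap kap_lin.
pose F : {linear g -> 'Hom(g, R^o)} := HB.pack kap L.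
have F_inj : lker (linfun F) == 0%VS.
  apply/lker0P => x y; rewrite !lfunE /= => /lfunP kxy.
  apply/eqP; rewrite -subr_eq0; apply/eqP/killing_eq0.
  by rewrite killingDl killingNl -!kapE kxy subrr.
have F_full : limg (linfun F) = fullv.
  apply/eqP; rewrite eqEdim subvf /= limg_dim_eq; last first.
    by rewrite (eqP F_inj) capv0.
  by rewrite !dimvf -[dim 'Hom(g, R^o)]/(dim g * 1)%N muln1.
pose Ll := GRing.isLinear.Build _ _ _ _ l l_lin.
pose G : {linear g -> R^o} := HB.pack l Ll.
have /memv_imgP[x _ lx] : linfun G \in limg (linfun F) by rewrite F_full memvf.
exists x => y; rewrite -kapE -[kap x]/(F x) -(lfunE F) -lx.
exact: (lfunE G).
Qed.

(** Represent y |-> tr(f ad y) by an element x; then f - ad x is a derivation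
    orthogonal to ad g for the trace form, and such a derivation maps every y to
    the radical of the Killing form. *)
Lemma derivation_inner f : derivation f -> exists x, f = ad x.
Proof.
move=> fD.
have l_lin : linear (fun y => trace_end (f \o ad y)%VF : R^o).
  by move=> a x y; rewrite ad_linear comp_lfunDr -comp_lfunZr; exact: trace_end_linear.
have [x xE] := killing_represents l_lin; exists x.
pose h := f - ad x.
have h_tr y : trace_end (h \o ad y)%VF = 0.
  rewrite /h comp_lfunDl comp_lfunNl trace_endB.
  by rewrite -[trace_end (ad x \o _)]/(killing x y) xE subrr.
have hD : derivation h.
  move=> y z; rewrite /h !add_lfunE !opp_lfunE fD derivation_ad.
  by rewrite !lieE opprD addrACA.
apply/eqP; rewrite -subr_eq0 -/h; apply/eqP/lfunP => y; rewrite zero_lfunE.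
suff k0 z : killing (h y) z = 0 by exact: killing_eq0.
rewrite /killing -derivation_ad_bracket// comp_lfunDl comp_lfunNl trace_endB -!comp_lfunA.
rewrite [trace_end (ad y \o _)]trace_endC -!comp_lfunA -trace_endB.
by rewrite -comp_lfunNr -comp_lfunDr -ad_lie h_tr.
Qed.

Lemma ad_inj : injective (@ad _ g).
Proof.
move=> x y xy; apply/eqP; rewrite -subr_eq0; apply/eqP/killing_eq0.
rewrite killingDl killingNl /killing xy; exact: subrr.
Qed.

End Compact.

(** * Exponentials of endomorphisms *)

Section ExponentialEndomorphism.
Variables (R : realType) (g : lieAlgType R).
Implicit Types (x y z : g) (f s : 'End(g)).
Local Notation e := (vbasis {:g}).
Local Notation Mx := (mxof e e).
Local Notation Hom := (hommx e e).

Let eP : basis_of {:g} e := vbasisP _.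

Lemma pascal_sum (V : lmodType R) (F : nat -> nat -> V) k :
  \sum_(0 <= i < k.+2) 'C(k.+1, i)%:R *: F i (k.+1 - i)%N =
  \sum_(0 <= i < k.+1) 'C(k, i)%:R *: (F i.+1 (k - i)%N + F i (k - i).+1).
Proof.
under [RHS]eq_bigr do rewrite scalerDr.
rewrite big_split /= big_nat_recl//.
under eq_bigr do rewrite binS natrD scalerDl subSS.
rewrite big_split /= addrA addrC; congr (_ + _).
have -> : \sum_(0 <= i < k.+1) 'C(k, i)%:R *: F i (k - i).+1 =
    \sum_(0 <= i < k.+2) 'C(k, i)%:R *: F i (k.+1 - i)%N.
  rewrite [RHS]big_nat_recr//= bin_small// scale0r addr0.
  by rewrite big_nat [RHS]big_nat; apply: eq_bigr => i /andP[_ ik]; rewrite subSn.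
by rewrite [RHS]big_nat_recl// !bin0 subn0.
Qed.

Lemma mxof_exp_end f : Mx (exp_end f) = expmx (Mx f).
Proof. by rewrite /exp_end hommxK. Qed.

Lemma exp_end_comm f s : (f \o s)%VF = (s \o f)%VF ->
  (exp_end f \o s)%VF = (s \o exp_end f)%VF.
Proof.
move=> fs; apply: (can_inj (mxofK eP eP)).
rewrite !(mxof_comp e e eP) !mxof_exp_end; apply/esym.
by apply: expmx_intertwine; rewrite -!(mxof_comp e e eP) fs.
Qed.

Lemma exp_end_opp f : cancel (exp_end f) (exp_end (- f)).
Proof.
move=> x; rewrite -comp_lfunE -[RHS]id_lfunE; congr (fun_of_lfun _ x).
apply: (can_inj (mxofK eP eP)).
rewrite (mxof_comp e e eP) !mxof_exp_end linearN /= mxof1 ?(basis_free eP)//.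
by have := expmx_opp (- Mx f); rewrite opprK.
Qed.

Lemma hommx_exprS f k x : Hom (Mx f ^+ k.+1) x = f (Hom (Mx f ^+ k) x).
Proof.
by rewrite exprSr (hommx_mul eP eP eP (Mx f ^+ k) (Mx f)) comp_lfunE mxofK.
Qed.

Lemma derivation_iter f k x y : derivation f ->
  Hom (Mx f ^+ k) (lie x y) =
  \sum_(0 <= i < k.+1) 'C(k, i)%:R *: lie (Hom (Mx f ^+ i) x) (Hom (Mx f ^+ (k - i)) y).
Proof.
move=> fD; elim: k => [|k IHk].
  by rewrite big_nat1 bin0 scale1r !expr0 (hommx1 eP) !id_lfunE.
rewrite hommx_exprS IHk linear_sum /=.
rewrite (pascal_sum (fun i j => lie (Hom (Mx f ^+ i) x) (Hom (Mx f ^+ j) y))).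
by apply: eq_bigr => i _; rewrite linearZ /= fD -!hommx_exprS.
Qed.

(** Both sides of the morphism identity are exponential series, and the Leibniz
    rule says that they agree term by term in the Cauchy product. *)
Lemma exp_end_automorphism f : derivation f -> lie_automorphism (exp_end f).
Proof.
move=> fD; apply: (automorphism_of_cancel (@exp_end_opp f)) => x y.
apply: coord_inj => j.
pose l (A : 'M[R]_(\dim {:g})) : R^o := coord e j (Hom A (lie x y)).
pose q (A B : 'M[R]_(\dim {:g})) : R^o := coord e j (lie (Hom A x) (Hom B y)).
apply: (@expmx_bilinear _ _ q l) => [Y a U V|X a U V|a U V|k].
- by rewrite /q !linearP /= add_lfunE scale_lfunE lieDl lieZl linearP.
- by rewrite /q !linearP /= add_lfunE scale_lfunE lieDr lieZr linearP.
- by rewrite /l linearP /= add_lfunE scale_lfunE linearP.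
by rewrite /l derivation_iter// linear_sum; apply: eq_bigr => i _; rewrite linearZ.
Qed.

Lemma exp_ad_automorphism x : lie_automorphism (exp_end (ad x)).
Proof. exact/exp_end_automorphism/derivation_ad. Qed.

Lemma hommx_linear_l x : linear (fun A => Hom A x).
Proof. by move=> a A B; rewrite linearP add_lfunE scale_lfunE. Qed.

Lemma exp_end_rotation f (theta : R) u v :
  f u = - theta *: v -> f v = theta *: u ->
  exp_end f u = cos theta *: u - sin theta *: v.
Proof.
move=> fu fv.
pose c k : R := (~~ odd k)%:R * (-1) ^+ k./2.
pose s k : R := (odd k)%:R * (-1) ^+ k.-1./2.
have sS k : s k.+1 = c k by rewrite /s /c /= .
have cS k : c k.+1 = - s k.
  rewrite /s /c /= negbK; case: (boolP (odd k)) => [|_]; last by rewrite !mul0r oppr0.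
  by case: k => // k _; rewrite !mul1r exprS mulN1r.
have powE k : Hom (Mx f ^+ k) u = theta ^+ k *: (c k *: u - s k *: v).
  elim: k => [|k IHk].
    rewrite !expr0 (hommx1 eP) id_lfunE scale1r /c /s /=.
    by rewrite mul0r scale0r subr0 expr0 mulr1 scale1r.
  rewrite hommx_exprS IHk linearZ linearB /= !linearZ /= fu fv sS cS.
  by rewrite exprSr; move: (c k) (s k) (theta ^+ k) => p q r; vring.
apply: coord_inj => j.
have l_lin : linear (fun A => coord e j (Hom A u) : R^o).
  by move=> a A B; rewrite hommx_linear_l linearP.
have := linear_expmx_cvg (A := Mx f) l_lin.
rewrite (_ : (fun N => _) = series (cos_coeff theta) * cst (coord e j u)
    - series (sin_coeff theta) * cst (coord e j v)); last first.
  apply/funext => N; rewrite /series /= !fctE !mulr_suml -sumrB.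
  apply: eq_bigr => k _; rewrite powE ?(linearD, linearN, linearZ) /= ?regular_scaleE.
  rewrite /cos_coeff /sin_coeff /c /s /= -?exprnP.
  by move: (_ ^+ k./2) (_ ^+ k.-1./2) (_`!%:R^-1) (~~ odd k)%:R (odd k)%:R => *; ring.
move=> fE.
have cE : series (cos_coeff theta) @ \oo --> cos theta.
  by rewrite trigo.cos.unlock; exact: is_cvg_series_cos_coeff.
have sE : series (sin_coeff theta) @ \oo --> sin theta.
  by rewrite trigo.sin.unlock; exact: is_cvg_series_sin_coeff.
have cst_cvg (a : R) : cst a @ \oo --> a by exact: cvg_cst.
have rE : (series (cos_coeff theta) * cst (coord e j u)
    - series (sin_coeff theta) * cst (coord e j v)) @ \oo -->
    cos theta * coord e j u - sin theta * coord e j v.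
  exact: (cvgB (cvgM cE (cst_cvg _)) (cvgM sE (cst_cvg _))).
have -> : coord e j (cos theta *: u - sin theta *: v) =
    cos theta * coord e j u - sin theta * coord e j v.
  by rewrite ?(linearD, linearN, linearZ) /= ?regular_scaleE; ring.
by rewrite -(cvg_lim _ rE)// -(cvg_lim _ fE).
Qed.

Lemma cubic_bound_critical (a b C N : R) : 0 <= C -> 0 <= N ->
  (forall s : R, `|s| * N <= 1 -> s * a + s ^+ 2 * b <= C * `|s| ^+ 3) ->
  a = 0 /\ b <= 0.
Proof.
move=> C0 N0 bnd.
have a_le0 a' : (forall s : R, 0 <= s -> s * N <= 1 -> s * a' + s ^+ 2 * b <= C * s ^+ 3) ->
    a' <= 0.
  move=> bnd'; rewrite leNgt; apply/negP => a0.
  have q0 : 0 <= (C + `|b|) / a' by apply: divr_ge0; [exact: addr_ge0 | exact: ltW].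
  pose D := N + 1 + (C + `|b|) / a'.
  have D1 : 1 <= D.
    by rewrite /D -addrA addrCA lerDl addr_ge0.
  have D0 : 0 < D by exact: lt_le_trans D1.
  pose s := D^-1.
  have s0 : 0 < s by rewrite invr_gt0.
  have s1 : s <= 1 by rewrite invf_le1.
  have sN : s * N <= 1.
    by rewrite mulrC ler_pdivrMr// mul1r /D -addrA lerDl addr_ge0.
  have sa : s * (C + `|b|) < a'.
    rewrite mulrC ltr_pdivrMr// /D mulrDr mulrCA mulfV ?gt_eqF// mulr1.
    by rewrite ltrDr mulr_gt0// ltr_pwDr.
  have := bnd' s (ltW s0) sN; apply/negP; rewrite -ltNge.
  have sC : C * s ^+ 3 <= s * (s * C).
    rewrite (_ : C * s ^+ 3 = s * (s * C) * s); last by ring.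
    by rewrite ler_piMr// !mulr_ge0// ltW.
  have sb : - (s * (s * `|b|)) <= s ^+ 2 * b.
    rewrite expr2 -mulrA -!mulrN ler_pM2l// ler_pM2l// lerNl -normrN.
    exact: ler_norm.
  have : s * (s * (C + `|b|)) < s * a' by rewrite ltr_pM2l.
  by rewrite !mulrDr; lra.
have a0 : a = 0.
  apply/eqP; rewrite eq_le a_le0 /=; last first.
    by move=> s s0 sN; have := bnd s; rewrite ger0_norm// => /(_ sN).
  rewrite -oppr_le0 a_le0// => s s0 sN.
  by have := bnd (- s); rewrite normrN ger0_norm// sqrrN mulrN mulNr => /(_ sN).
split=> //; rewrite leNgt; apply/negP => b0.
have q0 : 0 <= C / b by apply: divr_ge0 => //; exact: ltW.
pose D := N + 1 + C / b.
have D1 : 1 <= D.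
  by rewrite /D -addrA addrCA lerDl addr_ge0.
have D0 : 0 < D by exact: lt_le_trans D1.
have s0 : 0 < D^-1 by rewrite invr_gt0.
have sN : `|D^-1| * N <= 1.
  by rewrite gtr0_norm// mulrC ler_pdivrMr// mul1r /D -addrA lerDl addr_ge0.
have := bnd _ sN; rewrite a0 mulr0 add0r gtr0_norm// [_ ^+ 3]exprS mulrCA.
rewrite mulrC mulrA ler_pM2r ?exprn_gt0//; apply/negP; rewrite -ltNge.
rewrite mulrC ltr_pdivrMr// /D mulrDr mulrCA mulfV ?gt_eqF// mulr1.
by rewrite ltrDr mulr_gt0// ltr_pwDr.
Qed.

(** The exponential equals its second-order Taylor polynomial up to a cubic
    error, so a maximum along a one-parameter group passes the first and second
    derivative tests. *)
Lemma exp_end_critical (l : g -> R^o) f x : linear l ->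
  (forall s : R, l (exp_end (s *: f) x) <= l x) ->
  l (f x) = 0 /\ l (f (f x)) <= 0.
Proof.
move=> l_lin l_max.
pose L (A : 'M[R]_(\dim {:g})) : R^o := l (Hom A x).
have L_lin : linear L by move=> a A B; rewrite /L hommx_linear_l l_lin.
have [C C0 LC] := linear_mx_bounded L_lin.
pose LB := GRing.isLinear.Build _ _ _ _ L L_lin.
pose F : {linear 'M[R]_(\dim {:g}) -> R^o} := HB.pack L LB.
have LZ a A : L (a *: A) = a * L A by rewrite -[L (a *: A)]/(F (a *: A)) linearZ.
have LD A B : L (A + B) = L A + L B by exact: (linearD F).
suff [-> b0] : l (f x) = 0 /\ 2^-1 * l (f (f x)) <= 0.
  by split=> //; rewrite -(pmulr_rle0 _ (_ : 0 < 2^-1))// invr_gt0.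
pose N := nrm (Mx f).
apply: (@cubic_bound_critical _ _ (C * (expR 1 * N ^+ 3)) N).
- by rewrite !mulr_ge0 ?expR_ge0 ?exprn_ge0 ?nrm_ge0.
- exact: nrm_ge0.
move=> s sN; have := expmx_order3_le (A := s *: Mx f).
rewrite nrmZ => /(_ sN); set r := _ - _ => r_le.
have rE : expmx (s *: Mx f) = r + (1 + s *: Mx f + 2^-1 *: (s *: Mx f *m (s *: Mx f))).
  by rewrite /r subrK.
clearbody r.
have := l_max s; rewrite -[l (exp_end _ _)]/(L (expmx (Mx (s *: f)))).
rewrite linearZ /= rE -scalemxAl -scalemxAr !LD !LZ.
have -> : L 1 = l x by rewrite /L (hommx1 eP) id_lfunE.
have -> : L (Mx f) = l (f x) by rewrite /L (mxofK eP eP).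
have -> : L (Mx f *m Mx f) = l (f (f x)).
  by rewrite /L (hommx_mul eP eP eP) comp_lfunE !(mxofK eP eP).
have Lr : - (C * (expR 1 * (`|s| * N) ^+ 3)) <= L r.
  rewrite lerNl; apply: le_trans (ler_norm _) _; rewrite normrN.
  apply: le_trans (LC _) _; rewrite ler_wpM2l//.
  by apply: le_trans (norm_le_nrm _) _.
rewrite exprMn in Lr.
rewrite (_ : C * (expR 1 * N ^+ 3) * `|s| ^+ 3 = C * (expR 1 * (`|s| ^+ 3 * N ^+ 3))).
  by rewrite expr2; lra.
by ring.
Qed.

End ExponentialEndomorphism.

(** * Surjectivity of the exponential near the identity *)

Section Closure.
Variable R : realType.

Lemma closure_norm (V : normedModType R) (S : set V) x (eps : R) :
  closure S x -> 0 < eps -> exists2 y, S y & `|x - y| < eps.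
Proof.
move=> Sx e0; have [y [Sy xy]] := Sx _ (nbhsx_ballx x _ e0).
by exists y => //; move: xy; rewrite -ball_normE.
Qed.

(** This transfers to limits the equations that define automorphisms, such as
    A[x, y] = [Ax, Ay], which compare an affine and a quadratic function of A. *)
Lemma quadratic_closure m n (S : set 'M[R]_(m, n)) (c : R)
    (l : 'M[R]_(m, n) -> R^o) (q : 'M[R]_(m, n) -> 'M[R]_(m, n) -> R^o) :
  linear l -> (forall B, linear (q^~ B)) -> (forall A, linear (q A)) ->
  (forall A, S A -> c + l A = q A A) -> forall A, closure S A -> c + l A = q A A.
Proof.
move=> l_lin ql qr Sq A SA.
have [C C0 lC] := linear_mx_bounded l_lin.
have [D D0 qD] := bilinear_mx_bounded ql qr.
pose E : R := C + D * (`|A| + (`|A| + 1)).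
have E0 : 0 <= E by rewrite addr_ge0// mulr_ge0// !addr_ge0.
apply/eqP; rewrite -subr_eq0 -normr_eq0 eq_le normr_ge0 andbT.
apply/ler_addgt0Pl => eps eps0; rewrite addr0.
have eta0 : 0 < Num.min 1 (eps / (E + 1)).
  by rewrite lt_min ltr01 divr_gt0// ltr_pwDr.
have [B SB] := closure_norm SA eta0; rewrite lt_min => /andP[AB1 ABe].
have B_le : `|B| <= `|A| + 1.
  rewrite -[B](subKr A); apply: le_trans (ler_normB _ _) _.
  by rewrite lerD2l ltW.
have -> : c + l A - q A A = l (A - B) - (q (A - B) A + q B (A - B)).
  pose LB := GRing.isLinear.Build _ _ _ _ l l_lin.
  pose F : {linear 'M[R]_(m, n) -> R^o} := HB.pack l LB.
  pose L1 := GRing.isLinear.Build _ _ _ _ (q B) (qr B).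
  pose F1 : {linear 'M[R]_(m, n) -> R^o} := HB.pack (q B) L1.
  pose L2 := GRing.isLinear.Build _ _ _ _ (q^~ A) (ql A).
  pose F2 : {linear 'M[R]_(m, n) -> R^o} := HB.pack (q^~ A) L2.
  rewrite -[l (A - B)]/(F (A - B)) -[q B (A - B)]/(F1 (A - B)).
  rewrite -[q (A - B) A]/(F2 (A - B)) !linearB /=.
  by have := Sq B SB => /eqP; rewrite -subr_eq0 => /eqP SB0; lra.
have le1 : `|l (A - B) - (q (A - B) A + q B (A - B))| <= E * `|A - B|.
  apply: le_trans (ler_normB _ _) _; rewrite /E [leRHS]mulrDl lerD//.
  apply: le_trans (ler_normD _ _) _.
  rewrite mulrDr mulrDl lerD//.
    by apply: le_trans (qD _ _) _; rewrite -mulrA (mulrC `|A|).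
  apply: le_trans (qD _ _) _; rewrite -mulrA ler_wpM2l// ler_wpM2r//.
apply: le_trans le1 _; apply: (@le_trans _ _ ((E + 1) * `|A - B|)).
  by rewrite ler_wpM2r// lerDl.
by rewrite mulrC -ler_pdivlMr ?ltW// ltr_pwDr.
Qed.

Lemma closure_sub_closed (T : topologicalType) (S : set T) :
  (forall u, closure S u -> S u) -> closed S.
Proof.
by move=> cS; rewrite closure_id; apply/seteqP; split; [exact: subset_closure|].
Qed.

End Closure.

Section Newton.
Variables (R : realType) (d : nat).
Implicit Types a b w F : 'M[R]_d.

Lemma lipschitz_within_continuous (S : set 'M[R]_d) (f : 'M[R]_d -> R) (k : R) :
  (forall a b, S a -> S b -> `|f a - f b| <= k * `|a - b|) ->
  {within S, continuous f}.
Proof.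
move=> f_lip; apply/subspace_continuousP => a Sa.
apply/cvgrPdist_le => eps eps0.
have k0 : 0 < `|k| + 1 by rewrite ltr_pwDr.
have := nbhsx_ballx a _ (divr_gt0 eps0 k0); rewrite /within /=.
apply: filterS => b; rewrite -ball_normE /= => ab Sb.
apply: le_trans (f_lip _ _ Sa Sb) _.
apply: (@le_trans _ _ ((`|k| + 1) * `|a - b|)).
  by rewrite ler_wpM2r// (le_trans (ler_norm _))// lerDl.
by rewrite mulrC -ler_pdivlMr// ltW.
Qed.

(** Local surjectivity of the exponential, for a set G of matrices in which
    every element near 1 is tangent to the space W up to a quadratic error: the
    minimum of the distance from 1 to the F exp(a), with a small in W, cannot be
    positive, because one Newton step would decrease it. *)
Lemma exp_newton (W G : set 'M[R]_d) (C0 : R) :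
  0 <= C0 -> closed W -> W 0 -> (forall a b, W a -> W b -> W (a - b)) ->
  (forall F a, G F -> W a -> G (F *m expmx a)) ->
  (forall F, G F -> exists2 w, W w & nrm (F - 1 - w) <= C0 * nrm (F - 1) ^+ 2) ->
  exists2 delta : R, 0 < delta &
    forall F, G F -> nrm (F - 1) <= delta -> exists2 a, W a & F *m expmx a = 1.
Proof.
move=> C00 W_cl W0 WB G_exp G_tan.
pose E : R := expR 1.
have E1 : 1 <= E by rewrite -expR0 ler_expR.
have E0 : 0 < E by exact: lt_le_trans E1.
pose N1 := nrm (1 : 'M[R]_d); have N10 : 0 <= N1 by exact: nrm_ge0.
(* m is the radius of the ball of exponents: it makes the nonlinear part of exp
   at most 1/8 of the linear part; delta makes the quadratic error of a tangent
   vector at most 1/16 of its length and keeps the Newton step inside the ball. *)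
pose m := (8 * (E * (N1 + 1)))^-1.
have EN : 1 <= E * (N1 + 1) by rewrite mulr_ege1// lerDr.
have m0 : 0 < m by rewrite invr_gt0 mulr_gt0// (lt_le_trans ltr01).
have N11 : 0 < N1 + 1 by rewrite ltr_wpDl.
have EmN : E * m * (N1 + 1) = 8^-1.
  by rewrite /m; field; rewrite !gt_eqF.
have Em : E * m <= 8^-1.
  by rewrite -EmN ler_peMr ?lerDr// mulr_ge0 ?ltW.
have m8 : m <= 8^-1 by rewrite (le_trans _ Em)// ler_peMl// ltW.
have m1 : m <= 1 by lra.
pose delta := m / (16 * ((N1 + 4) * (C0 + 1))).
have NC0 : 0 < (N1 + 4) * (C0 + 1) by rewrite mulr_gt0// ltr_pwDr.
have d0 : 0 < delta by rewrite divr_gt0// mulr_gt0.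
have dNC : delta * ((N1 + 4) * (C0 + 1)) = m / 16.
  by rewrite /delta; field; rewrite !gt_eqF// ltr_pwDr.
have C11 : 1 <= C0 + 1 by rewrite lerDr.
have N41 : 1 <= N1 + 4 by rewrite (@le_trans _ _ 4)// ?lerDr// ler1n.
have dN : delta * (N1 + 4) <= m / 16.
  by rewrite -dNC mulrA ler_peMr// mulr_ge0 ?ltW// (lt_le_trans ltr01).
have dC : C0 * delta <= 16^-1.
  apply: (@le_trans _ _ (m / 16)); last by lra.
  rewrite -dNC mulrC ler_wpM2l ?(ltW d0)//.
  by apply: (@le_trans _ _ (C0 + 1)); rewrite ?lerDl// ler_peMl// (le_trans ler01).
have d64 : delta <= 64^-1.
  apply: (@le_trans _ _ (m / 16)); last by lra.
  by rewrite -dNC ler_peMr ?(ltW d0)// mulr_ege1.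
exists delta => // F GF Fd.
pose B := [set a : 'M[R]_d | W a /\ nrm a <= m].
have B0 : B 0 by split; rewrite ?nrm0 ?ltW.
have B_cl : closed B.
  apply: closedI => //.
  by apply: (@preimage_closed _ _ (@nrm R d) [set x | x <= m]) => [a _|];
    [exact: nrm_continuous | exact: closed_le].
have B_cpt : compact B.
  apply: (@mx_bounded_closed_compact _ _ _ _ m) => // a [_].
  exact: le_trans (norm_le_nrm _).
pose phi a := nrm (F *m expmx a - 1).
have phi_cont : {within B, continuous phi}.
  apply: (@lipschitz_within_continuous _ _ (nrm F * 2 * d%:R)) => a b [_ am] [_ bm].
  have tri' (u v : 'M[R]_d) : nrm u - nrm v <= nrm (u - v).
    by rewrite lerBlDr -{1}[u](subrK v) nrmD.
  have tri (u v : 'M[R]_d) : `|nrm u - nrm v| <= nrm (u - v).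
    by rewrite ler_norml tri' andbT lerNl opprB -(nrmN (u - v)) opprB tri'.
  apply: le_trans (tri _ _) _; rewrite opprB addrA subrK -mulmxBr.
  apply: le_trans (nrmM _ _) _; rewrite -!mulrA ler_wpM2l ?nrm_ge0//.
  have ab : d%:R * `|a - b| = nrm (a - b) by rewrite nrm.unlock.
  rewrite ab -[expmx a - _](subrK (a - b)); apply: le_trans (nrmD _ _) _.
  have := expmx_sub_le am bm m1; have := nrm_ge0 (a - b).
  rewrite -/E => ab0 le1.
  have : E * m * nrm (a - b) <= 8^-1 * nrm (a - b) by rewrite ler_wpM2r.
  by lra.
have [a + a_min] := compact_EVT_min (ex_intro _ _ B0) B_cpt phi_cont.
rewrite inE => -[Wa am].
exists a => //.
pose D := F *m expmx a - 1; pose n := nrm D.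
have n0 : 0 <= n by exact: nrm_ge0.
have nF : n <= nrm (F - 1).
  have := a_min 0; rewrite inE => /(_ B0); rewrite /phi expmx0.
  by rewrite -[F *m 1]/(F * 1) mulr1.
have nd : n <= delta by exact: le_trans Fd.
have Fn : nrm F <= N1 + 1.
  rewrite -[F](subrK 1) addrC; apply: le_trans (nrmD _ _) _; rewrite lerD2l; lra.
have ea : nrm (expmx a - 1 - a) <= 2^-1 * nrm a.
  have := @expmx_sub_le R d a 0 m am; rewrite nrm0 expmx0 subr0.
  move=> /(_ (ltW m0) m1) le1.
  by apply: le_trans le1 _; rewrite ler_wpM2r ?nrm_ge0//; rewrite -/E; lra.
have a_small : nrm a <= 2 * delta * (N1 + 3).
  have a0 := nrm_ge0 a.
  have e_le : nrm (expmx a) <= N1 + 2.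
    have -> : expmx a = (expmx a - 1 - a) + a + 1 by rewrite !subrK.
    apply: le_trans (nrmD _ _) _; rewrite -/N1.
    have := nrmD (expmx a - 1 - a) a; lra.
  have e1 : nrm (expmx a - 1) <= delta + delta * (N1 + 2).
    have -> : expmx a - 1 = D - (F - 1) *m expmx a.
      rewrite /D mulmxBl mul1mx; move: (F *m expmx a) (expmx a) => x y.
      by apply/matrixP => i j; rewrite !mxE; ring.
    apply: le_trans (nrmB _ _) _; rewrite lerD//.
    apply: le_trans (nrmM _ _) _.
    by rewrite ler_pM ?nrm_ge0.
  have := nrmB (expmx a - 1) (expmx a - 1 - a).
  by rewrite subKr; lra.
(* The step replaces a by a - w, where w is the tangent direction of F exp(a). *)
have [w Ww Dw] := G_tan _ (G_exp _ _ GF Wa).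
rewrite -/D -/n in Dw.
have Dw' : nrm (D - w) <= 16^-1 * n.
  apply: le_trans Dw _; rewrite expr2 mulrA ler_wpM2r//.
  by apply: le_trans dC; rewrite ler_wpM2l.
have wn : nrm w <= 2 * n.
  rewrite -[w](subKr D); apply: le_trans (nrmB _ _) _; rewrite -/n; lra.
have a'm : nrm (a - w) <= m.
  apply: le_trans (nrmB _ _) _; lra.
have := a_min (a - w); rewrite inE => /(_ (conj (WB _ _ Wa Ww) a'm)).
rewrite /phi -/D -/n.
pose err := expmx (a - w) - expmx a - (a - w - a).
have err_le : nrm err <= E * m * nrm w.
  have := expmx_sub_le a'm am m1; rewrite -/err.
  by rewrite [a - w - a]addrAC subrr add0r nrmN.
have -> : F *m expmx (a - w) - 1 = (D - w) - (F - 1) *m w + F *m err.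
  rewrite /err [a - w - a]addrAC subrr add0r opprK !mulmxDr mulmxN mulmxBl mul1mx.
  rewrite /D; move: (F *m expmx a) (F *m expmx (a - w)) (F *m w) => x y z.
  by apply/matrixP => i j; rewrite !mxE; ring.
move=> n_le.
suff : n <= 0.
  by move=> n_le0; apply/eqP; rewrite -subr_eq0; apply/eqP/nrm_eq0/eqP; rewrite eq_le n_le0.
have := nrmD (D - w - (F - 1) *m w) (F *m err).
have := nrmB (D - w) ((F - 1) *m w).
have Fw : nrm ((F - 1) *m w) <= 64^-1 * (2 * n).
  apply: le_trans (nrmM _ _) _; rewrite ler_pM ?nrm_ge0//.
  exact: le_trans d64.
have Fe : nrm (F *m err) <= 8^-1 * (2 * n).
  apply: le_trans (nrmM _ _) _.
  apply: (@le_trans _ _ ((N1 + 1) * (E * m * (2 * n)))).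
    rewrite ler_pM ?nrm_ge0//; apply: le_trans err_le _.
    by rewrite ler_wpM2l// mulr_ge0 ?ltW.
  by rewrite mulrA (mulrC (N1 + 1)) EmN.
by lra.
Qed.

End Newton.

(** * Compactness of the inner group of h *)

Section InnerGroup.
Variables (R : realType) (g : lieAlgType R).
Hypothesis g_compact : compact_lie g.
Variables (sigma : 'End(g)) (sigma_aut : lie_automorphism sigma).
Local Notation h := (fixedSpace sigma).
Local Notation e := (vbasis {:g}).
Local Notation d := (\dim {:g}).
Local Notation Mx := (mxof e e).
Local Notation Hom := (hommx e e).
Implicit Types (x y z : g) (f phi : 'End(g)).

Let eP : basis_of {:g} e := vbasisP _.

Lemma Int_group_aut s f : Int_group s f -> lie_automorphism f.
Proof.
elim=> [x _||f1 f2 _ A1 _ A2|f1 _ A1].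
- exact: exp_ad_automorphism.
- exact: automorphism_id.
- exact: automorphism_comp.
- exact: automorphism_inv.
Qed.

Lemma Int_group_comm f : Int_group h f -> (f \o sigma)%VF = (sigma \o f)%VF.
Proof.
elim=> [x xh||f1 f2 _ A1 _ A2|f1 If A1].
- apply: exp_end_comm; apply/lfunP => y; rewrite !comp_lfunE !adE (proj2 sigma_aut).
  by move: xh => /fixedSpaceP ->.
- by rewrite comp_lfun1l comp_lfun1r.
- by rewrite -comp_lfunA A2 comp_lfunA A1 comp_lfunA.
have fA := Int_group_aut If.
apply/lfunP => x; apply: (can_inj (automorphismK fA)).
have := congr1 (fun u : 'End(g) => u (f1^-1%VF x)) A1.
by rewrite !comp_lfunE !(automorphismVK fA).
Qed.

(** Each coordinate is the scalar product with a fixed vector, and automorphisms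
    preserve the lengths of the basis vectors. *)
Lemma mxof_aut_bounded :
  exists2 B : R, 0 <= B & forall f, lie_automorphism f -> nrm (Mx f) <= B.
Proof.
have uE j : exists u, forall y, killing u y = coord e j y.
  by apply: killing_represents => // a x y; rewrite linearP.
have [u {}uE] := choice uE.
pose c i j := - killing (u j) (u j) - killing e`_i e`_i.
have c0 i j : 0 <= c i j by rewrite addr_ge0 ?oppr_ge0 ?killing_le0.
pose B := \sum_(i < d) \sum_(j < d) c i j.
have B0 : 0 <= B by do 2![apply: sumr_ge0 => ? _].
exists (d%:R * B); first by rewrite mulr_ge0.
move=> f fA; rewrite nrm.unlock ler_wpM2l//; apply: mx_norm_le => // i j.
have -> : Mx f i j = coord e j (f e`_i).
  by rewrite mxE /= vecof_delta -coord_rVof.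
rewrite -uE; apply: (@le_trans _ _ (c i j)); last first.
  rewrite /B (bigD1 i)//= (bigD1 j)//= -addrA lerDl addr_ge0//.
    by apply: sumr_ge0.
  by do 2![apply: sumr_ge0 => ? _].
have := killing_automorphism e`_i e`_i fA; set v := f _ => vE.
rewrite /c -vE ler_norml.
have := killing_le0 g_compact (u j + v); have := killing_le0 g_compact (u j - v).
have := killing_le0 g_compact (u j); have := killing_le0 g_compact v.
rewrite !killingE (killingC v (u j)) => ? ? ? ?.
by apply/andP; split; lra.
Qed.

(** The linearization at 1 of the conditions for being an automorphism that
    commutes with sigma; the Leibniz rule is tested on the basis only. *)
Definition defect f : {ffun 'I_d * 'I_d -> g} * 'End(g) :=
  ([ffun p : 'I_d * 'I_d =>
      f (lie e`_p.1 e`_p.2) - lie (f e`_p.1) e`_p.2 - lie e`_p.1 (f e`_p.2)],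
   (f \o sigma)%VF - (sigma \o f)%VF).

Lemma defect_linear : linear defect.
Proof.
move=> a f1 f2; congr pair.
  apply/ffunP => p; rewrite !ffunE !add_lfunE !scale_lfunE !lieE.
  by vring.
rewrite comp_lfunDl comp_lfunDr -comp_lfunZl -comp_lfunZr /=.
by rewrite scalerBr opprD addrACA.
Qed.

HB.instance Definition _ := GRing.isLinear.Build _ _ _ _ defect defect_linear.

Lemma bilinear_basis_ext (b1 b2 : g -> g -> g) :
  (forall y, linear (b1^~ y)) -> (forall x, linear (b1 x)) ->
  (forall y, linear (b2^~ y)) -> (forall x, linear (b2 x)) ->
  (forall i j : 'I_d, b1 e`_i e`_j = b2 e`_i e`_j) -> b1 =2 b2.
Proof.
move=> l1 r1 l2 r2 b12 x y.
have ext (f1 f2 : g -> g) : linear f1 -> linear f2 ->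
    (forall i : 'I_d, f1 e`_i = f2 e`_i) -> f1 =1 f2.
  move=> f1l f2l f12 z.
  pose L1 := GRing.isLinear.Build _ _ _ _ f1 f1l.
  pose F1 : {linear g -> g} := HB.pack f1 L1.
  pose L2 := GRing.isLinear.Build _ _ _ _ f2 f2l.
  pose F2 : {linear g -> g} := HB.pack f2 L2.
  rewrite -[f1 z]/(F1 z) -[f2 z]/(F2 z) (coord_vbasis (memvf z)) !linear_sum.
  by apply: eq_bigr => i _; rewrite !linearZ /= f12.
apply: (ext (b1^~ y) (b2^~ y)) => // i.
by apply: (ext (b1 e`_i) (b2 e`_i)) => // j.
Qed.

Lemma defect_eq0 f : defect f = 0 -> exists2 x, x \in h & f = ad x.
Proof.
case=> /ffunP fD /eqP; rewrite subr_eq0 => /eqP f_sigma.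
have f_der : derivation f.
  apply: (@bilinear_basis_ext (fun x y => f (lie x y)) (fun x y => lie (f x) y + lie x (f y))).
  - by move=> y a u v; rewrite lieDl lieZl linearP.
  - by move=> x a u v; rewrite lieDr lieZr linearP.
  - by move=> y a u v; rewrite /= linearP !lieE; vring.
  - by move=> x a u v; rewrite !linearP; vring.
  - move=> i j; have := fD (i, j); rewrite !ffunE /= => /eqP.
    by rewrite -addrA -opprD subr_eq0 => /eqP.
have [x fx] := derivation_inner g_compact f_der; exists x => //.
apply/fixedSpaceP; apply: (ad_inj g_compact).
rewrite (automorphism_ad _ sigma_aut) -fx -f_sigma; apply/lfunP => y.
by rewrite !comp_lfunE (automorphismVK sigma_aut).
Qed.

(** The quadratic term that the linearization drops. *)
Definition bracket_defect f1 f2 : {ffun 'I_d * 'I_d -> g} * 'End(g) :=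
  ([ffun p : 'I_d * 'I_d => lie (f1 e`_p.1) (f2 e`_p.2)], 0).

Lemma defect_aut f : lie_automorphism f -> (f \o sigma)%VF = (sigma \o f)%VF ->
  defect (f - \1%VF) = bracket_defect (f - \1%VF) (f - \1%VF).
Proof.
move=> [_ fM] f_sigma; congr pair.
  apply/ffunP => p; rewrite !ffunE !add_lfunE !opp_lfunE !id_lfunE fM !lieE.
  by vring.
rewrite comp_lfunDl comp_lfunDr comp_lfunNl comp_lfunNr comp_lfun1l comp_lfun1r.
by rewrite f_sigma subrr.
Qed.

(** For D = f - 1, subtracting from D a preimage of its defect gives w with
    defect 0; the preimage depends linearly on the defect, which is quadratic in
    D by defect_aut. *)
Lemma automorphism_tangent : exists2 C : R, 0 <= C &
  forall f, lie_automorphism f -> (f \o sigma)%VF = (sigma \o f)%VF ->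
  exists2 w, defect w = 0 & nrm (Mx f - 1 - Mx w) <= C * nrm (Mx f - 1) ^+ 2.
Proof.
pose L := linfun defect.
pose q (A B : 'M[R]_d) : 'M[R]_d := Mx (L^-1%VF (bracket_defect (Hom A) (Hom B))).
have ql B : linear (q^~ B).
  move=> a A1 A2; rewrite /q.
  have -> : bracket_defect (Hom (a *: A1 + A2)) (Hom B) =
      a *: bracket_defect (Hom A1) (Hom B) + bracket_defect (Hom A2) (Hom B).
    congr pair; last by rewrite /= scaler0 addr0.
    apply/ffunP => p; rewrite !ffunE linearP add_lfunE scale_lfunE.
    by rewrite lieDl lieZl.
  by rewrite linearP /= linearP.
have qr A : linear (q A).
  move=> a B1 B2; rewrite /q.
  have -> : bracket_defect (Hom A) (Hom (a *: B1 + B2)) =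
      a *: bracket_defect (Hom A) (Hom B1) + bracket_defect (Hom A) (Hom B2).
    congr pair; last by rewrite /= scaler0 addr0.
    apply/ffunP => p; rewrite !ffunE linearP add_lfunE scale_lfunE.
    by rewrite lieDr lieZr.
  by rewrite linearP /= linearP.
have [C C0 qC] := bilinear_mx_bounded ql qr.
exists (d%:R * C); first by rewrite mulr_ge0.
move=> f fA f_sigma; pose D := f - \1%VF.
have DE : defect D = L D by rewrite lfunE.
pose r := L^-1%VF (defect D).
have rE : defect r = defect D.
  by rewrite -[defect r](lfunE (defect : {linear _ -> _})) limg_lfunVK// DE memv_img// memvf.
exists (D - r); first by rewrite linearB /= rE subrr.
have M1 : Mx \1%VF = 1 by rewrite mxof1// (basis_free eP).
have MD : Mx f - 1 = Mx D by rewrite linearB /= M1.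
have -> : Mx (D - r) = Mx D - Mx r by exact: linearB.
rewrite MD subKr.
have -> : Mx r = q (Mx D) (Mx D).
  by rewrite /q !(mxofK eP eP) /r (defect_aut fA f_sigma).
have -> : nrm (q (Mx D) (Mx D)) = d%:R * `|q (Mx D) (Mx D)| by rewrite nrm.unlock.
rewrite -mulrA ler_wpM2l// (le_trans (qC _ _))// ler_wpM2l//.
by rewrite expr2 ler_pM// norm_le_nrm.
Qed.

Lemma exp_end_hommx a : Hom (expmx a) = exp_end (Hom a).
Proof. by rewrite /exp_end hommxK. Qed.

(** Int(h) is open in the group of automorphisms that commute with sigma: both
    have the Lie algebra ad h, since derivations of g are inner. *)
Lemma Int_group_near1 : exists2 delta : R, 0 < delta &
  forall f, lie_automorphism f -> (f \o sigma)%VF = (sigma \o f)%VF ->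
    nrm (Mx f - 1) <= delta -> Int_group h f.
Proof.
pose W := [set a : 'M[R]_d | defect (Hom a) = 0].
pose G := [set F : 'M[R]_d |
  lie_automorphism (Hom F) /\ (Hom F \o sigma)%VF = (sigma \o Hom F)%VF].
have [C C0 tan] := automorphism_tangent.
have W_cl : closed W.
  apply: closure_sub_closed => a Wa; rewrite /W /=.
  apply: coord_inj => j; rewrite linear0.
  pose l (A : 'M[R]_d) : R^o := coord (vbasis fullv) j (defect (Hom A)).
  have l_lin : linear l by move=> c A B; rewrite /l !linearP.
  have := @quadratic_closure _ _ _ W 0 l (fun _ _ => 0) l_lin.
  rewrite -/(l a) => lq; rewrite -[l a]add0r; apply: lq => //.
  - by move=> B c A A'; rewrite scaler0 addr0.
  - by move=> B c A A'; rewrite scaler0 addr0.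
  by move=> A WA; rewrite add0r /l (WA : defect _ = 0) linear0.
have W0 : W 0 by rewrite /W /= !linear0.
have WB a b : W a -> W b -> W (a - b).
  by rewrite /W /= !linearB /= => -> ->; rewrite subrr.
have G_exp F a : G F -> W a -> G (F *m expmx a).
  move=> [FA Fs] /defect_eq0[x xh ax]; rewrite /G /=.
  have exI : Int_group h (exp_end (ad x)) by exact: Int_exp.
  rewrite (hommx_mul eP eP eP) exp_end_hommx ax.
  split; first exact: automorphism_comp (exp_ad_automorphism x) FA.
  by rewrite -comp_lfunA Fs comp_lfunA (Int_group_comm exI) comp_lfunA.
have G_tan F : G F -> exists2 w, W w & nrm (F - 1 - w) <= C * nrm (F - 1) ^+ 2.
  move=> [FA Fs]; have [w w0] := tan _ FA Fs; rewrite !(hommxK eP eP) => wF.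
  by exists (Mx w); rewrite // /W /= (mxofK eP eP).
have [delta d0 near1] := exp_newton C0 W_cl W0 WB G_exp G_tan.
exists delta => // f fA fs fd.
have Gf : G (Mx f) by rewrite /G /= !(mxofK eP eP).
have [a /defect_eq0[x xh ax] fa] := near1 _ Gf fd.
have ef : (exp_end (ad x) \o f)%VF = \1%VF.
  by rewrite -ax -exp_end_hommx -{1}(mxofK eP eP f) -(hommx_mul eP eP eP) fa (hommx1 eP).
have eA := exp_ad_automorphism x.
have -> : f = (exp_end (ad x))^-1%VF.
  apply/lfunP => y; apply: (can_inj (automorphismK eA)).
  by rewrite (automorphismVK eA) -comp_lfunE ef id_lfunE.
by apply: Int_inv; exact: Int_exp.
Qed.

(** For a limit f of elements of Int(h), some f' in Int(h) is so close to f that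
    Int_group_near1 applies to the quotient of f by f'. *)
Lemma Int_group_compact : compact [set M | Int_group h (Hom M)].
Proof.
set S := [set M | _].
have [B B0 S_bnd] := mxof_aut_bounded.
have [delta d0 near1] := Int_group_near1.
have S_nrm M : S M -> nrm M <= B.
  by move=> /Int_group_aut/S_bnd; rewrite (hommxK eP eP).
apply: (@mx_bounded_closed_compact _ _ _ _ B) => [M SM|].
  exact: le_trans (norm_le_nrm _) (S_nrm _ SM).
apply: closure_sub_closed => M SM.
have lin_l (u : g) (l : g -> R^o) : linear l -> linear (fun A => l (Hom A u)).
  by move=> l_lin a A A'; rewrite hommx_linear_l l_lin.
have zl : linear ((fun=> 0) : 'M[R]_d -> R^o) by move=> c A A'; rewrite scaler0 addr0.
have MM x y : Hom M (lie x y) = lie (Hom M x) (Hom M y).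
  apply: coord_inj => j.
  pose q (A A' : 'M[R]_d) : R^o := coord e j (lie (Hom A x) (Hom A' y)).
  have := @quadratic_closure _ _ _ S 0 (fun A => coord e j (Hom A (lie x y))) q.
  move=> /(_ (lin_l _ _ _))/(_ _ _ _ _ SM); rewrite add0r; apply.
  - by move=> a u v; rewrite linearP.
  - by move=> A a U V; rewrite /q hommx_linear_l lieDl lieZl linearP.
  - by move=> A a U V; rewrite /q hommx_linear_l lieDr lieZr linearP.
  - by move=> A SA; rewrite add0r /q (proj2 (Int_group_aut SA)).
have MK x : killing (Hom M x) (Hom M x) = killing x x.
  pose q (A A' : 'M[R]_d) : R^o := killing (Hom A x) (Hom A' x).
  have ql A' : linear (q^~ A').
    by move=> a U V; rewrite /q hommx_linear_l killingDl killingZl.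
  have qr A : linear (q A).
    by move=> a U V; rewrite /q hommx_linear_l killingDr killingZr.
  have Sq A : S A -> killing x x + 0 = q A A.
    by move=> SA; rewrite addr0 /q killing_automorphism//; exact: Int_group_aut SA.
  by have := quadratic_closure zl ql qr Sq SM; rewrite addr0.
have Ms : (Hom M \o sigma)%VF = (sigma \o Hom M)%VF.
  apply/lfunP => x; rewrite !comp_lfunE; apply: coord_inj => j.
  pose l (A : 'M[R]_d) : R^o := coord e j (Hom A (sigma x)) - coord e j (sigma (Hom A x)).
  have l_lin : linear l.
    by move=> a A A'; rewrite /l !hommx_linear_l !linearP /= ?regular_scaleE; ring.
  have := @quadratic_closure _ _ _ S 0 l (fun _ _ => 0) l_lin (fun _ => zl) (fun _ => zl).
  move=> /(_ _ _ SM) lM; apply/eqP; rewrite -subr_eq0; apply/eqP.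
  rewrite -[LHS]add0r; apply: lM => A SA; rewrite add0r /l.
  by rewrite -!comp_lfunE (Int_group_comm SA) subrr.
have MA : lie_automorphism (Hom M).
  split=> //; apply/eqP/lker0P => x y Mxy.
  apply/eqP; rewrite -subr_eq0; apply/eqP/(killing_eq0 g_compact).
  by rewrite -MK linearB /= Mxy subrr killing0r.
have eta0 : 0 < delta / (d%:R * B + 1) by rewrite divr_gt0// ltr_wpDl// mulr_ge0.
have [M' SM' MM'] := closure_norm SM eta0.
have A' := Int_group_aut SM'.
pose f := ((Hom M')^-1 \o Hom M)%VF.
have fA : lie_automorphism f by apply: automorphism_comp => //; exact: automorphism_inv.
have IV : Int_group h (Hom M')^-1%VF by exact: Int_inv.
have fs : (f \o sigma)%VF = (sigma \o f)%VF.
  by rewrite /f -comp_lfunA Ms comp_lfunA (Int_group_comm IV) comp_lfunA.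
have If : Int_group h f.
  apply: near1 => //.
  have -> : Mx f - 1 = (M - M') *m Mx (Hom M')^-1%VF.
    rewrite (mxof_comp e e eP) (hommxK eP eP) mulmxBl; congr (_ - _).
    rewrite -{1}(hommxK eP eP M') -(mxof_comp e e eP).
    have <- : Mx \1%VF = 1 by rewrite mxof1// (basis_free eP).
    congr (Mx _); apply/lfunP => y.
    by rewrite comp_lfunE id_lfunE (automorphismK A').
  apply: le_trans (nrmM _ _) _.
  have nI := S_bnd _ (automorphism_inv A').
  have -> : nrm (M - M') = d%:R * `|M - M'| by rewrite nrm.unlock.
  have : d%:R * `|M - M'| * nrm (Mx (Hom M')^-1%VF) <= d%:R * `|M - M'| * B.
    by rewrite ler_wpM2l// mulr_ge0.
  move=> /le_trans; apply; rewrite mulrAC.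
  apply: (@le_trans _ _ ((d%:R * B + 1) * `|M - M'|)).
    by rewrite ler_wpM2r// lerDl.
  rewrite mulrC -ler_pdivlMr; first exact: ltW.
  by rewrite ltr_wpDl// mulr_ge0.
rewrite /S /=.
have -> : Hom M = (Hom M' \o f)%VF.
  by apply/lfunP => y; rewrite !comp_lfunE (automorphismVK A').
exact: Int_comp.
Qed.

(** Compactness of Int(h) itself, not only of its closure, provides a conjugating
    element that is a product of exponentials. *)
Lemma Int_group_max (l : g -> R^o) x : linear l ->
  exists2 mu, Int_group h mu & forall mu', Int_group h mu' -> l (mu' x) <= l (mu x).
Proof.
move=> l_lin; set S := [set M | Int_group h (Hom M)].
have S1 : S (Mx \1%VF) by rewrite /S /= (mxofK eP eP); exact: Int_id.
have L_lin : linear (fun A => l (Hom A x) : R^o).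
  by move=> a A A'; rewrite hommx_linear_l l_lin.
have L_cont : {within S, continuous (fun A => l (Hom A x) : R)}.
  by apply: continuous_subspaceT; exact: linear_mx_continuous L_lin.
have [M + M_max] := compact_EVT_max (ex_intro _ _ S1) Int_group_compact L_cont.
rewrite inE => SM; exists (Hom M) => // mu Imu.
have := M_max (Mx mu); rewrite inE /S /= !(mxofK eP eP); exact.
Qed.

End InnerGroup.

(** * Regular elements fixed by an involution *)

Section RegularElements.
Variables (R : realType) (g : lieAlgType R).
Hypothesis g_compact : compact_lie g.
Implicit Types (x y z : g) (s : {vspace g}).
Local Notation d := (\dim {:g}).

Definition lie_subalg s := forall x y, x \in s -> y \in s -> lie x y \in s.

Definition cent s x : {vspace g} := (s :&: lker (ad x))%VS.
Arguments cent s%_VS x%_R.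

Lemma centP s x y : reflect (y \in s /\ lie x y = 0) (y \in cent s x).
Proof.
rewrite memv_cap memv_ker adE; apply: (iffP andP) => -[ys /eqP xy //].
Qed.

Lemma killing_orthogonal_size p (v : 'I_p -> g) :
  (forall i, v i != 0) -> (forall i j, i != j -> killing (v i) (v j) = 0) ->
  (p <= d)%N.
Proof.
move=> v0 v_orth.
pose X := [tuple v i | i < p].
have XE (i : 'I_p) : X`_i = v i by rewrite -tnth_nth tnth_mktuple.
have v_free : free X.
  apply/freeP => k kv0 i.
  pose L := GRing.isLinear.Build _ _ _ _ _ (killing_linear_r (v i)).
  pose F : {linear g -> R^o} := HB.pack (killing (v i) : g -> R^o) L.
  have := congr1 F kv0; rewrite linear_sum linear0 (bigD1 i)//= big1 => [|j ji].
    rewrite XE addr0 killingZr => /eqP; rewrite mulf_eq0 => /orP[/eqP//|/eqP].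
    by move=> /(killing_eq0 g_compact) vi; have := v0 i; rewrite vi eqxx.
  by rewrite XE killingZr v_orth 1?eq_sym// mulr0.
by have := dimvS (subvf <<X>>); rewrite (eqP v_free) size_tuple.
Qed.

(** For all but finitely many c, the kernel of ad A + c ad B is the intersection
    of the kernels of ad A and ad B: exceptional values of c have nonzero
    witnesses in the image of ad A that are pairwise orthogonal. *)
Lemma cent_sub_of_minimal s A B : lie_subalg s -> A \in s -> B \in s -> lie A B = 0 ->
  (forall c : R, (\dim (cent s A) <= \dim (cent s (A + c *: B)%R))%N) ->
  (cent s A <= cent s B)%VS.
Proof.
move=> s_sub As Bs AB dim_min.
have BA : lie B A = 0 by rewrite lie_anti AB oppr0.
have [c [c0 c_good]] : exists c : R, c != 0 /\
    forall y, y \in s -> lie (A + c *: B) (lie A y) = 0 -> lie A y = 0.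
  apply: contrapT => no_c.
  have bad (i : 'I_d.+1) : exists y, [/\ y \in s,
      lie A (lie A y) = - i.+1%:R *: lie B (lie A y) & lie A y != 0].
    apply: contrapT => no_y; apply: no_c; exists i.+1%:R; split.
      by rewrite pnatr_eq0.
    move=> y ys; rewrite lieDl lieZl => /eqP; rewrite addr_eq0 => /eqP yA.
    apply/eqP/negPn/negP => y0; apply: no_y; exists y; split=> //.
    by rewrite scaleNr.
  have [y yP] := choice bad.
  pose w i := lie A (y i).
  have wA i : lie A (w i) = - i.+1%:R *: lie B (w i) by have [] := yP i.
  have w_neq0 i : lie A (w i) != 0.
    have [_ _] := yP i; apply: contra => /eqP ww.
    by apply/eqP; exact: (lie_lie_eq0 g_compact).
  have w_orth i j : i != j -> killing (lie A (w i)) (lie A (w j)) = 0.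
    move=> ij; set q := killing (lie A (lie B (w i))) (w j).
    have e1 : killing (lie A (w i)) (lie A (w j)) = i.+1%:R * q.
      have := killing_invariant (lie A (w i)) (w j) A.
      by rewrite {1}wA lieZr killingZl /q; lra.
    have e2 : killing (lie A (w i)) (lie A (w j)) = j.+1%:R * q.
      have := killing_invariant (lie A (w i)) (w j) B.
      by rewrite (wA j) killingZr (lie_comm (w i) BA) -/q => ->; ring.
    have ij_neq : i.+1%:R - j.+1%:R != 0 :> R.
      by rewrite subr_eq0 eqr_nat eqSS.
    have : (i.+1%:R - j.+1%:R) * q = 0 by rewrite mulrBl -e1 -e2 subrr.
    by move=> /eqP; rewrite mulf_eq0 (negbTE ij_neq) /= => /eqP q0; rewrite e1 q0 mulr0.
  by have := killing_orthogonal_size w_neq0 w_orth; rewrite ltnn.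
have sub_A : (cent s (A + c *: B) <= cent s A)%VS.
  apply/subvP => x /centP[xs xAB]; apply/centP; split=> //; apply: c_good => //.
  by rewrite lie_comm ?xAB ?lie0r// lieDl lieZl liexx BA scaler0 addr0.
have sub_B : (cent s (A + c *: B) <= cent s B)%VS.
  apply/subvP => x xAB; have /centP[xs xA] := subvP sub_A _ xAB.
  apply/centP; split=> //; move: xAB => /centP[_].
  rewrite lieDl lieZl xA add0r => /eqP; rewrite scaler_eq0 (negbTE c0) /=.
  by move/eqP.
have /eqP <- : cent s (A + c *: B) == cent s A by rewrite eqEdim sub_A dim_min.
exact: sub_B.
Qed.

Lemma exists_dim_min (P : g -> Prop) (f : g -> {vspace g}) x0 : P x0 ->
  exists2 x, P x & forall y, P y -> (\dim (f x) <= \dim (f y))%N.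
Proof.
move=> Px0; pose Q n := `[< exists2 x, P x & \dim (f x) = n >].
have exQ : exists n, Q n by exists (\dim (f x0)); apply/asboolP; exists x0.
case: (ex_minnP exQ) => n /asboolP[x Px <-] n_min; exists x => // y Py.
by apply: n_min; apply/asboolP; exists y.
Qed.

(** If the centralizer of a tau-fixed A is as small as possible, then all its
    tau-fixed elements are central in it, and brackets of anti-fixed elements,
    being fixed, are orthogonal to themselves. *)
Lemma involution_fixed_regular s (tau : 'End(g)) :
  lie_subalg s -> involutive_automorphism tau -> (tau @: s)%VS = s ->
  exists A, [/\ A \in s, tau A = A & abelian_subalg (cent s A)].
Proof.
move=> s_sub [tau_aut tau2] tau_s.
have tauM := proj2 tau_aut.
have tauK x : tau (tau x) = x by rewrite -comp_lfunE tau2 id_lfunE.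
have tau_in x : x \in s -> tau x \in s by move=> xs; rewrite -tau_s memv_img.
pose P x := x \in s /\ tau x = x.
have P0 : P 0 by split; rewrite ?mem0v ?linear0.
have [A [As tauA] A_min] := exists_dim_min (cent s) P0.
exists A; split=> //.
have fix_central B x : B \in s -> tau B = B -> lie A B = 0 ->
    x \in cent s A -> lie B x = 0.
  move=> Bs tauB AB xA; have : (cent s A <= cent s B)%VS.
    apply: cent_sub_of_minimal => // c; apply: A_min; split.
      by rewrite memvD ?memvZ.
    by rewrite linearD linearZ /= tauA tauB.
  by move=> /subvP/(_ _ xA)/centP[].
have cent_tau x : x \in cent s A -> tau x \in cent s A.
  move=> /centP[xs Ax]; apply/centP; split; first exact: tau_in.
  by rewrite -tauA -tauM Ax linear0.
pose xp x := 2^-1 *: (x + tau x); pose xm x := 2^-1 *: (x - tau x).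
have xE x : x = xp x + xm x.
  apply: coord_inj => j; rewrite /xp /xm ?(linearD, linearN, linearZ) /= ?regular_scaleE; lra.
have xpA x : x \in cent s A -> xp x \in cent s A by move=> xA; rewrite memvZ ?memvD ?cent_tau.
have xmA x : x \in cent s A -> xm x \in cent s A by move=> xA; rewrite memvZ ?memvB ?cent_tau.
have tau_xp x : tau (xp x) = xp x by rewrite linearZ linearD /= tauK addrC.
have tau_xm x : tau (xm x) = - xm x.
  by rewrite linearZ linearB /= tauK -scalerN opprB.
have cent_lie x y : x \in cent s A -> y \in cent s A -> lie x y \in cent s A.
  move=> /centP[xs Ax] /centP[ys Ay]; apply/centP; split; first exact: s_sub.
  by rewrite lie_jacobi Ax Ay lie0l lie0r addr0.
have xp_central x y : x \in cent s A -> y \in cent s A -> lie (xp x) y = 0.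
  move=> xA yA; have /centP[ps pA] := xpA x xA.
  exact: fix_central.
(* The bracket z of the two anti-fixed parts is fixed, hence central, and
   killing z z = - killing (xm y) [xm x, z] = 0. *)
have anti x y : x \in cent s A -> y \in cent s A -> lie (xm x) (xm y) = 0.
  move=> xA yA; have zA := cent_lie _ _ (xmA x xA) (xmA y yA).
  have /centP[zs Az] := zA.
  have z_fix : tau (lie (xm x) (xm y)) = lie (xm x) (xm y).
    by rewrite tauM !tau_xm !lieE opprK.
  apply: (killing_eq0 g_compact); rewrite killing_invariant.
  rewrite (lie_anti (xm x)) (fix_central (lie (xm x) (xm y)) (xm x))//.
    by rewrite oppr0 killing0r oppr0.
  exact: xmA.
move=> x y xA yA.
rewrite (xE x) lieDl xp_central// add0r (xE y) lieDr anti// addr0.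
by rewrite lie_anti xp_central ?oppr0// xmA.
Qed.

End RegularElements.

(** * Conjugacy into a torus and a chamber *)

Section TorusConjugacy.
Variables (R : realType) (g : lieAlgType R).
Hypothesis g_compact : compact_lie g.
Variables (sigma : 'End(g)) (sigma_aut : lie_automorphism sigma).
Local Notation h := (fixedSpace sigma).
Implicit Types (x y z : g).

Lemma fixed_subalg : lie_subalg h.
Proof.
move=> x y /fixedSpaceP xh /fixedSpaceP yh; apply/fixedSpaceP.
by rewrite (proj2 sigma_aut) xh yh.
Qed.

Lemma Int_group_stable mu x : Int_group h mu -> x \in h -> mu x \in h.
Proof.
move=> Imu /fixedSpaceP xh; apply/fixedSpaceP.
by rewrite -comp_lfunE -(Int_group_comm sigma_aut Imu) comp_lfunE xh.
Qed.

(** The element mu A maximizing the scalar product with T on the orbit of A is a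
    critical point, hence commutes with T and lies in t. The Hessian at this
    maximum puts mu A and T in a common closed Weyl chamber. *)
Lemma torus_chamber_conjugacy (t : {vspace g}) T A :
  max_abelian_subalg t -> (t <= h)%VS -> T \in t -> (cent h T <= t)%VS ->
  A \in h -> abelian_subalg (cent h A) ->
  exists mu, [/\ Int_group h mu, mu A \in t, cent h (mu A) = t &
    forall z, z \in h -> killing (lie (mu A) z) (lie T z) <= 0].
Proof.
move=> [t_ab t_max] th Tt T_reg Ah A_ab.
have l_lin : linear (fun y => - killing y T : R^o).
  by move=> a x y; rewrite killingDl killingZl regular_scaleE; ring.
have [mu Imu mu_max] := Int_group_max g_compact sigma_aut A l_lin.
have mu_aut := Int_group_aut Imu.
have crit z : z \in h ->
    - killing (lie z (mu A)) T = 0 /\ - killing (lie z (lie z (mu A))) T <= 0.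
  move=> zh; have := @exp_end_critical _ _ _ (ad z) (mu A) l_lin.
  rewrite !adE; apply => s; rewrite -comp_lfunE; apply: mu_max; apply: Int_comp => //.
  have -> : s *: ad z = ad (s *: z).
    by apply/lfunP => y; rewrite scale_lfunE !adE lieZl.
  by apply: Int_exp; rewrite memvZ.
have muAh : mu A \in h by exact: Int_group_stable.
have Th := subvP th _ Tt.
have muT : lie (mu A) T = 0.
  apply: (killing_eq0 g_compact).
  have zh : lie (mu A) T \in h by exact: fixed_subalg.
  have [+ _] := crit _ zh.
  rewrite (lie_anti _ (mu A)) killingNl opprK killing_invariant => /eqP.
  by rewrite oppr_eq0 => /eqP.
have muAt : mu A \in t.
  apply: (subvP T_reg); apply/centP; split=> //.
  by rewrite lie_anti muT oppr0.
have cent_ab : abelian_subalg (cent h (mu A)).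
  have inv x : x \in cent h (mu A) -> mu^-1%VF x \in cent h A.
    move=> /centP[xh Ax]; apply/centP; split.
      by apply: Int_group_stable => //; exact: Int_inv.
    apply: (can_inj (automorphismK mu_aut)).
    by rewrite (proj2 mu_aut) (automorphismVK mu_aut) Ax linear0.
  move=> x y xA yA.
  rewrite -(automorphismVK mu_aut x) -(automorphismVK mu_aut y) -(proj2 mu_aut).
  by rewrite (A_ab _ _ (inv x xA) (inv y yA)) linear0.
exists mu; split=> // [|z zh].
  apply: t_max => //; apply/subvP => x xt; apply/centP; split; first exact: subvP th _ xt.
  exact: t_ab.
have [_] := crit z zh.
rewrite oppr_le0 killing_invariant oppr_ge0 => le0.
by rewrite (lie_anti _ z) (lie_anti T) killingNl killingNr opprK.
Qed.

End TorusConjugacy.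

(** * Complexification *)

Section CommonEigenvector.

Lemma common_eigenvector_lfun (C : numClosedFieldType) (V : vectType C)
    (U : {vspace V}) (fs : seq 'End(V)) :
  U != 0%VS -> {in fs, forall f : 'End(V), (f @: U <= U)%VS} ->
  {in fs &, forall f1 f2 : 'End(V), (f1 \o f2)%VF = (f2 \o f1)%VF} ->
  exists2 z, z \in U /\ z != 0 & {in fs, forall f : 'End(V), exists a, f z = a *: z}.
Proof.
move=> U0 fsU fs_comm.
pose e := vbasis {:subvs_of U}; have eP : basis_of {:subvs_of U} e := vbasisP _.
pose r (f : 'End(V)) : 'End(subvs_of U) := (linfun (vsproj U) \o f \o linfun vsval)%VF.
have rE f (w : subvs_of U) : f \in fs -> vsval (r f w) = f (vsval w).
  move=> ffs; rewrite !comp_lfunE !lfunE /= vsprojK//.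
  by apply: (subvP (fsU f ffs)); rewrite memv_img// subvsP.
have dU : (0 < \dim {:subvs_of U})%N.
  by rewrite dimvf /dim /= lt0n dimv_eq0.
pose Ms := [seq mxof e e (r f) | f <- fs].
have Ms_comm : {in Ms &, forall A B, comm_mx A B}.
  move=> _ _ /mapP[f1 f1s ->] /mapP[f2 f2s ->].
  rewrite /comm_mx -!(mxof_comp e e eP); congr mxof.
  apply/lfunP => w; apply: val_inj; rewrite !(comp_lfunE (r _)).
  change (vsval (r f2 (r f1 w)) = vsval (r f1 (r f2 w))).
  rewrite !rE// -!comp_lfunE; congr (fun_of_lfun _ _).
  exact: fs_comm.
have [v v0 /allP vM] := common_eigenvector dU Ms_comm.
exists (vsval (vecof e v)).
  split; first exact: subvsP.
  apply/eqP => w0; case/eqP: v0; apply/eqP; rewrite -(vecof_eq0 eP); apply/eqP.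
  by apply: subvs_inj; rewrite w0 linear0.
move=> f ffs; have /vM := map_f (fun f => mxof e e (r f)) ffs.
move=> /sub_rVP[a va]; exists a.
rewrite -rE// (hom_vecof _ eP) va !linearZ.
by [].
Qed.

End CommonEigenvector.

Section ComplexificationLemmas.
Variables (R : realType) (V : vectType R).
Implicit Types (s : {vspace V}) (z : complexification V).

Lemma scaleC1 (a : R[i]) z : (a *: z).1 = complex.Re a *: z.1 - complex.Im a *: z.2.
Proof. by case: a. Qed.

Lemma scaleC2 (a : R[i]) z : (a *: z).2 = complex.Re a *: z.2 + complex.Im a *: z.1.
Proof. by case: a. Qed.

Lemma toC_decomp z : z = toC z.1 + 'i%C *: toC z.2.
Proof.
case: z => x y; rewrite /toC; apply: injective_projections => /=.
  by rewrite scale0r scaler0 subr0 addr0.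
by rewrite scale0r scale1r !add0r.
Qed.

Lemma toC_linear (a : R) x y : toC (a *: x + y) = a%:C *: toC x + toC y :> complexification V.
Proof.
by apply: injective_projections; rewrite /= ?scaleC1 ?scaleC2 /= ?scale0r ?scaler0 ?subr0 ?addr0.
Qed.

Lemma complexify_spaceP s z :
  reflect (z.1 \in s /\ z.2 \in s) (z \in complexify_space s).
Proof.
have toC_in x : x \in s -> toC x \in complexify_space s.
  move=> xs; rewrite (coord_vbasis xs).
  apply: (@big_ind _ (fun y => toC y \in complexify_space s)) => [|y1 y2 y1s y2s|j _].
  - exact: mem0v.
  - by rewrite -(scale1r y1) toC_linear memvD// memvZ.
  - rewrite -[_ *: _]addr0 toC_linear [toC 0](_ : _ = 0)// addr0 memvZ// memv_span//.
    by rewrite map_f// mem_nth// size_tuple.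
apply: (iffP idP) => [|[z1 z2]]; last by rewrite (toC_decomp z) memvD ?memvZ ?toC_in.
move=> /coord_span ->.
apply: (@big_ind _ (fun w : complexification V => w.1 \in s /\ w.2 \in s)).
- by split; exact: mem0v.
- by move=> w1 w2 [? ?] [? ?]; split; exact: memvD.
move=> j _.
have bj : (vbasis s)`_j \in s by rewrite vbasis_mem// mem_nth// size_tuple.
rewrite (nth_map 0) ?size_tuple//.
by rewrite scaleC1 scaleC2 /= !scaler0 subr0 add0r; split; rewrite memvZ.
Qed.

End ComplexificationLemmas.

(** * Roots in real form *)

Section Weights.
Variables (R : realType) (g : lieAlgType R).
Hypothesis g_compact : compact_lie g.
Variable t : {vspace g}.
Local Notation gC := (complexification g).
Local Notation tC := (complexify_space t).
Implicit Types (b : dual_tC t) (P Q x y u v : g) (z : gC).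

Lemma gC_ext z1 z2 : z1.1 = z2.1 -> z1.2 = z2.2 -> z1 = z2.
Proof. exact: injective_projections. Qed.

(** Real points of the complexified torus. *)
Definition emb P : subvs_of tC := vsproj tC (toC P).

Lemma embE P : P \in t -> vsval (emb P) = toC P.
Proof. by move=> Pt; apply/vsprojK/complexify_spaceP; rewrite Pt mem0v. Qed.

Lemma subvs_re (H : subvs_of tC) : (vsval H).1 \in t.
Proof. by have /complexify_spaceP[] := subvsP H. Qed.

Lemma subvs_im (H : subvs_of tC) : (vsval H).2 \in t.
Proof. by have /complexify_spaceP[] := subvsP H. Qed.

Lemma emb_decomp (H : subvs_of tC) : H = emb (vsval H).1 + 'i%C *: emb (vsval H).2.
Proof.
apply: subvs_inj; rewrite linearD linearZ /= !embE ?subvs_re ?subvs_im//.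
exact: toC_decomp.
Qed.

(** Roots take imaginary values on t: a root b is i times its real weight. *)
Definition rweight b P : R := complex.Im (b (emb P)).

Definition imaginary b := forall P, P \in t -> complex.Re (b (emb P)) = 0.

Lemma dual_ext b1 b2 : imaginary b1 -> imaginary b2 ->
  (forall P, P \in t -> rweight b1 P = rweight b2 P) -> b1 = b2.
Proof.
move=> i1 i2 b12; apply/lfunP => H; rewrite [H]emb_decomp !linearD !linearZ /=.
have eqP P : P \in t -> b1 (emb P) = b2 (emb P).
  move=> Pt; move: (i1 P Pt) (i2 P Pt) (b12 P Pt); rewrite /rweight.
  by case: (b1 _) (b2 _) => [? ?] [? ?] /= -> -> ->.
by rewrite !eqP ?subvs_re ?subvs_im.
Qed.

Lemma rweightD b1 b2 P : rweight (b1 + b2) P = rweight b1 P + rweight b2 P.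
Proof. by rewrite /rweight add_lfunE; case: (b1 _) (b2 _) => [? ?] []. Qed.

Lemma rweightN b P : rweight (- b) P = - rweight b P.
Proof. by rewrite /rweight opp_lfunE; case: (b _). Qed.

Lemma rweight0 P : rweight 0 P = 0.
Proof. by rewrite /rweight zero_lfunE. Qed.

Lemma rweightMn b k P : rweight (b *+ k) P = rweight b P *+ k.
Proof. by elim: k => [|k IHk]; rewrite ?mulr0n ?rweight0// !mulrS rweightD IHk. Qed.

Lemma rweight_sum I (r : seq I) (p : pred I) (F : I -> dual_tC t) P :
  rweight (\sum_(i <- r | p i) F i) P = \sum_(i <- r | p i) rweight (F i) P.
Proof. by apply: (big_morph (rweight^~ P)) => [b1 b2|]; rewrite ?rweightD ?rweight0. Qed.

Lemma emb_linear : linear_for (fun (a : R) (w : subvs_of tC) => a%:C *: w) emb.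
Proof. by move=> a P Q; rewrite /emb toC_linear linearP. Qed.

Lemma rweight_linear b : linear (rweight b : g -> R^o).
Proof.
move=> a P Q; rewrite /rweight emb_linear linearD linearZ /=.
by case: (b (emb P)) (b (emb Q)) => [? ?] [? ?] /=; rewrite mul0r addr0.
Qed.

Lemma rweightDr b P Q : rweight b (P + Q) = rweight b P + rweight b Q.
Proof. by have := rweight_linear b 1 P Q; rewrite !scale1r. Qed.

Lemma rweightZr b (a : R) P : rweight b (a *: P) = a * rweight b P.
Proof.
have r0 : rweight b 0 = 0 by apply: (addrI (rweight b 0)); rewrite -rweightDr !addr0.
by have := rweight_linear b a P 0; rewrite r0 !addr0.
Qed.

Lemma rweightNr b P : rweight b (- P) = - rweight b P.
Proof. by rewrite -scaleN1r rweightZr mulN1r. Qed.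

Lemma rweight_sumr b I (r : seq I) (p : pred I) (F : I -> g) :
  rweight b (\sum_(i <- r | p i) F i) = \sum_(i <- r | p i) rweight b (F i).
Proof.
apply: (big_morph (rweight b) (rweightDr b)).
by apply: (addrI (rweight b 0)); rewrite -rweightDr !addr0.
Qed.

Lemma imaginaryN b : imaginary b -> imaginary (- b).
Proof.
move=> ib P Pt; move: (ib P Pt); rewrite opp_lfunE.
by case: (b _) => [? ?] /= ->; rewrite oppr0.
Qed.

(** u + iv is a weight vector for b, in real coordinates. *)
Definition weight_vector b u v :=
  [/\ (u != 0) || (v != 0),
      forall P, P \in t -> lie P u = - rweight b P *: v &
      forall P, P \in t -> lie P v = rweight b P *: u].

Lemma lie_toC P u v : lie (toC P : gC) ((u, v) : gC) = (lie P u, lie P v).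
Proof. by apply: gC_ext; rewrite /= !lie0l ?subr0 ?addr0. Qed.

(** ad P is skew for the negative definite Killing form, so the real part of
    b(P) vanishes. *)
Lemma root_weight_vector b : is_root b ->
  imaginary b /\ exists u v, weight_vector b u v.
Proof.
move=> [b0 [[u v] z0 bz]].
have bP P : P \in t -> let a := b (emb P) in
    lie P u = complex.Re a *: u - complex.Im a *: v /\
    lie P v = complex.Re a *: v + complex.Im a *: u.
  move=> Pt; have := bz (emb P); rewrite embE// lie_toC => bPz.
  split; first by have := congr1 (fun w : gC => w.1) bPz; rewrite /= scaleC1.
  by have := congr1 (fun w : gC => w.2) bPz; rewrite /= scaleC2.
have uv0 : (u != 0) || (v != 0).
  rewrite -negb_and; apply: contra z0 => /andP[/eqP -> /eqP ->].
  by apply/eqP.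
have ib : imaginary b.
  move=> P Pt; have [/= Pu Pv] := bP P Pt.
  have := killing_lie_self u P; have := killing_lie_self v P.
  rewrite Pu Pv !killingE (killingC v u) => e1 e2.
  set a := complex.Re _ in e1 e2 *.
  have uv_neg : killing u u + killing v v < 0.
    have := killing_le0 g_compact u; have := killing_le0 g_compact v.
    by case/orP: uv0 => /g_compact; lra.
  have : a * (killing u u + killing v v) = 0 by move: e1 e2; rewrite -/a; lra.
  by move=> /eqP; rewrite mulf_eq0 (lt_eqF uv_neg) orbF => /eqP.
split=> //; exists u, v; split=> // P Pt; have [/= Pu Pv] := bP P Pt.
  by rewrite Pu ib// scale0r add0r scaleNr.
by rewrite Pv ib// scale0r add0r.
Qed.

Lemma weight_vector_root b u v :
  b != 0 -> imaginary b -> weight_vector b u v -> is_root b.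
Proof.
move=> b0 ib [uv0 Pu Pv]; split=> //; exists ((u, v) : gC).
  apply/eqP => /(congr1 (fun w : gC => (w.1, w.2))) /= [u0 v0].
  by move: uv0; rewrite u0 v0 eqxx.
have bP P : P \in t -> lie (toC P : gC) ((u, v) : gC) = b (emb P) *: ((u, v) : gC).
  move=> Pt; rewrite lie_toC; apply: gC_ext.
    by rewrite scaleC1 /= ib// scale0r add0r Pu// scaleNr.
  by rewrite scaleC2 /= ib// scale0r add0r Pv.
move=> H; rewrite {1}[H]emb_decomp linearD linearZ /= !embE ?subvs_re ?subvs_im//.
rewrite lieDl lieZl !bP ?subvs_re ?subvs_im// scalerA -scalerDl.
by rewrite {3}[H]emb_decomp linearD linearZ.
Qed.

Lemma weight_vector_opp b u v : weight_vector b u v -> weight_vector (- b) u (- v).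
Proof.
move=> [uv0 Pu Pv]; split; rewrite ?oppr_eq0// => P Pt; rewrite rweightN.
  by rewrite Pu// opprK scaleNr scalerN.
by rewrite lieNr Pv// scaleNr.
Qed.

(** The opposite root belongs to the conjugate weight vector. *)
Lemma root_opp b : is_root b -> is_root (- b).
Proof.
move=> broot; have [ib [u [v uv]]] := root_weight_vector broot.
apply: (@weight_vector_root _ u (- v)); last exact: weight_vector_opp.
  by case: broot; rewrite oppr_eq0.
exact: imaginaryN.
Qed.

Hypothesis t_max : max_abelian_subalg t.

Lemma cent_max_abelian x : (forall P, P \in t -> lie P x = 0) -> x \in t.
Proof.
move=> Px; have [t_ab t_max'] := t_max.
have s_ab : abelian_subalg (t + <[x]>)%VS.
  move=> _ _ /memv_addP[P Pt [_ /vlineP[a ->] ->]] /memv_addP[Q Qt [_ /vlineP[c ->] ->]].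
  rewrite !lieE t_ab// Px// liexx (lie_anti x Q) Px//.
  by rewrite !(oppr0, scaler0, addr0).
by rewrite -(t_max' _ s_ab (addvSl _ _)) (subvP (addvSr t _))// memv_line.
Qed.

(** A common eigenvector of t in the image of ad P on c has a nonzero weight,
    because the kernel and the image of the skew map ad P meet in 0. *)
Lemma exists_root_vector (c : {vspace g}) P x :
  (forall Q y, Q \in t -> y \in c -> lie Q y \in c) ->
  P \in t -> x \in c -> lie P x != 0 ->
  exists b u v, [/\ is_root b, weight_vector b u v, u \in c & v \in c].
Proof.
move=> c_stable Pt xc Px; have [t_ab _] := t_max.
pose U := (ad P @: c)%VS.
pose UC := complexify_space U.
have U_sub y : y \in U -> y \in c.
  by move=> /memv_imgP[w wc ->]; rewrite adE c_stable.
have U_stable Q y : Q \in t -> y \in U -> lie Q y \in U.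
  move=> Qt /memv_imgP[w wc ->]; rewrite adE (lie_comm _ (t_ab _ _ Qt Pt)) -adE.
  by rewrite memv_img// c_stable.
have UC0 : UC != 0%VS.
  apply/eqP => UC0; have : toC (lie P x) \in UC.
    by apply/complexify_spaceP; rewrite mem0v -adE memv_img.
  rewrite UC0 memv0 => /eqP/(congr1 (fun w : gC => w.1)) /= Px0.
  by rewrite Px0 eqxx in Px.
pose fs := [seq ad (H : gC) | H <- vbasis tC].
have tC_in (H : gC) : H \in vbasis tC -> H.1 \in t /\ H.2 \in t.
  by move=> /vbasis_mem/complexify_spaceP.
have fs_stable : {in fs, forall f : 'End(gC), (f @: UC <= UC)%VS}.
  move=> _ /mapP[H /tC_in[H1 H2] ->]; apply/subvP => y.
  move=> /memv_imgP[w /complexify_spaceP[w1 w2] ->].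
  rewrite adE; apply/complexify_spaceP; rewrite /= memvB ?memvD ?U_stable//.
have fs_comm : {in fs &, forall f1 f2 : 'End(gC), (f1 \o f2)%VF = (f2 \o f1)%VF}.
  move=> _ _ /mapP[H /tC_in[H1 H2] ->] /mapP[H' /tC_in[H1' H2'] ->].
  apply/lfunP => w; rewrite !comp_lfunE !adE lie_comm//.
  by apply: gC_ext; rewrite /= !t_ab ?subr0 ?addr0.
have [[u v] [/complexify_spaceP[/= uU vU] z0] z_eig] :=
  common_eigenvector_lfun UC0 fs_stable fs_comm.
set z : gC := (u, v) in z0 z_eig.
have z_eigen (H : gC) : H \in tC -> exists a, lie H z = a *: z.
  move=> HtC; rewrite (coord_vbasis HtC).
  apply: (@big_ind _ (fun H : gC => exists a, lie H z = a *: z)).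
  - by exists 0; rewrite lie0l scale0r.
  - by move=> H1 H2 [a1 e1] [a2 e2]; exists (a1 + a2); rewrite lieDl e1 e2 scalerDl.
  move=> j _; have Hj : (vbasis tC)`_j \in vbasis tC by rewrite mem_nth// size_tuple.
  have [a e] := z_eig _ (map_f _ Hj); rewrite adE in e.
  by eexists; rewrite lieZl e scalerA.
have [j zj] : exists j, coord (vbasis {:gC}) j z != 0.
  apply: contrapT => no_j; case/eqP: z0; apply: coord_inj => j; rewrite linear0.
  by apply/eqP/negPn/negP => zj; apply: no_j; exists j.
(* All lie H z are multiples of z, and the multiplier is read off at a
   coordinate j where z does not vanish. *)
pose bf (H : subvs_of tC) : (complex R)^o :=
  coord (vbasis {:gC}) j (lie (vsval H) z) / coord (vbasis {:gC}) j z.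
have bf_lin : linear bf.
  move=> a H1 H2; rewrite /bf linearP /= lieDl lieZl linearP /=.
  by rewrite mulrDl -mulrA.
pose L := GRing.isLinear.Build _ _ _ _ bf bf_lin.
pose F : {linear subvs_of tC -> (complex R)^o} := HB.pack bf L.
pose b : dual_tC t := linfun F.
have bz H : lie (vsval H) z = (b H : R[i]) *: z.
  have [a e] := z_eigen _ (subvsP H).
  by rewrite lfunE /= /bf e linearZ /= mulfK.
have b0 : b != 0.
  apply/eqP => b0; have [w wc uw] := memv_imgP uU; have [w' wc' vw] := memv_imgP vU.
  have := bz (emb P); rewrite embE// b0 zero_lfunE scale0r lie_toC.
  move=> zz; have Pu := congr1 (fun w : gC => w.1) zz.
  have Pv := congr1 (fun w : gC => w.2) zz; rewrite /= in Pu Pv.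
  rewrite adE in uw; rewrite adE in vw.
  case/eqP: z0; apply: gC_ext => /=; rewrite ?uw ?vw.
    by apply: lie_lie_eq0 => //; rewrite -uw.
  by apply: lie_lie_eq0 => //; rewrite -vw.
have broot : is_root b by split=> //; exists z.
have [ib _] := root_weight_vector broot.
exists b, u, v; split; rewrite ?U_sub//.
split=> [|Q Qt|Q Qt].
- rewrite -negb_and; apply: contra z0 => /andP[/eqP u0 /eqP v0].
  by apply/eqP; rewrite /z u0 v0.
- have := bz (emb Q); rewrite embE// lie_toC => /(congr1 (fun w : gC => w.1)) /= ->.
  by rewrite scaleC1 /= ib// scale0r add0r scaleNr.
have := bz (emb Q); rewrite embE// lie_toC => /(congr1 (fun w : gC => w.2)) /= ->.
by rewrite scaleC2 /= ib// scale0r add0r.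
Qed.

End Weights.

(** * Roots of the fixed subalgebra *)

Section FixedRoots.
Variables (R : realType) (g : lieAlgType R).
Hypothesis g_compact : compact_lie g.
Variable t : {vspace g}.
Hypothesis t_max : max_abelian_subalg t.
Variable X : g.
Hypothesis Xt : X \in t.
Local Notation sigma := (exp_end (ad X)).
Local Notation h := (fixedSpace sigma).
Hypothesis th : (t <= h)%VS.
Implicit Types (b : dual_tC t) (P u v : g).

(** The roots of h = g^sigma with respect to t. *)
Definition fixed_root b :=
  is_root b /\ exists u v, [/\ weight_vector b u v, u \in h & v \in h].

Lemma sigma_weight_vector b u v : weight_vector b u v ->
  sigma u = cos (rweight b X) *: u - sin (rweight b X) *: v /\
  sigma v = cos (rweight b X) *: v + sin (rweight b X) *: u.
Proof.
move=> [_ bu bv]; split.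
  by apply: exp_end_rotation; rewrite adE ?bu ?bv.
rewrite (@exp_end_rotation _ _ (ad X) (rweight b X) v (- u)) ?adE ?lieNr ?bu ?bv//.
- by rewrite scalerN opprK.
- by rewrite scaleNr scalerN opprK.
- by rewrite scaleNr opprK.
Qed.

Lemma root_fixed b :
  is_root b -> cos (rweight b X) = 1 -> sin (rweight b X) = 0 -> fixed_root b.
Proof.
move=> broot c1 s0; split=> //; have [_ [u [v uv]]] := root_weight_vector g_compact broot.
have [su sv] := sigma_weight_vector uv.
exists u, v; split=> //; apply/fixedSpaceP.
  by rewrite su c1 s0 scale1r scale0r subr0.
by rewrite sv c1 s0 scale1r scale0r addr0.
Qed.

Lemma fixed_root_opp b : fixed_root b -> fixed_root (- b).
Proof.
move=> [broot [u [v [uv uh vh]]]]; split; first exact: root_opp.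
by exists u, (- v); split; rewrite ?memvN//; exact: weight_vector_opp.
Qed.

Lemma root_imaginary b : is_root b -> imaginary b.
Proof. by move=> /(root_weight_vector g_compact)[]. Qed.

Lemma root_rweight_neq0 b : is_root b -> exists2 P, P \in t & rweight b P != 0.
Proof.
move=> broot; apply: contrapT => no_P; case: (broot) => /eqP b0 _; apply: b0.
apply: dual_ext => [||P Pt]; first exact: root_imaginary.
  by move=> P _; rewrite zero_lfunE.
by rewrite rweight0; apply/eqP/negPn/negP => bP; apply: no_P; exists P.
Qed.

Lemma weight_vector_neq0 b u v : is_root b -> weight_vector b u v -> v != 0.
Proof.
move=> broot [uv0 _ bv]; apply/eqP => v0; have [P Pt bP] := root_rweight_neq0 broot.
have /eqP := bv P Pt; rewrite v0 lie0r eq_sym scaler_eq0 (negbTE bP) /= => /eqP u0.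
by rewrite u0 v0 eqxx in uv0.
Qed.

(** On the plane of u and v, sigma is the rotation by the angle b(X). *)
Lemma fixed_root_cos b : fixed_root b -> cos (rweight b X) = 1.
Proof.
move=> [broot [u [v [uv /fixedSpaceP uh /fixedSpaceP vh]]]].
have v0 := weight_vector_neq0 broot uv.
have [su sv] := sigma_weight_vector uv; rewrite uh in su; rewrite vh in sv.
move: (cos _) (sin _) (cos2Dsin2 (rweight b X)) su sv => c s cs su sv.
have eu : (1 - c) *: u = - s *: v by rewrite scalerBl scale1r {1}su; vring.
have ev : (1 - c) *: v = s *: u by rewrite scalerBl scale1r {1}sv; vring.
have : (2 - 2 * c) *: v = 0.
  have -> : 2 - 2 * c = (1 - c) * (1 - c) + s * s by move: cs; rewrite !expr2; lra.
  rewrite scalerDl -!scalerA ev.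
  have -> : s *: v = - ((1 - c) *: u) by rewrite eu scaleNr opprK.
  by vring.
by move=> /eqP; rewrite scaler_eq0 (negbTE v0) orbF => /eqP; lra.
Qed.

(** If the centralizer of T in h were larger than t, it would contain a weight
    vector, and its root would vanish at T. *)
Lemma regular_of_roots T : T \in t ->
  (forall b, fixed_root b -> rweight b T != 0) -> (cent h T <= t)%VS.
Proof.
move=> Tt T_reg; have [t_ab _] := t_max; apply/subvP => x xT.
apply: (cent_max_abelian t_max) => P Pt; apply/eqP/negPn/negP => Px.
have c_stable Q y : Q \in t -> y \in cent h T -> lie Q y \in cent h T.
  move=> Qt /centP[yh Ty]; apply/centP; split.
    by apply: (fixed_subalg (exp_ad_automorphism X)) => //; exact: (subvP th).
  by rewrite (lie_comm _ (t_ab _ _ Tt Qt)) Ty lie0r.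
have [b [u [v [broot uv uT vT]]]] := exists_root_vector g_compact t_max c_stable Pt xT Px.
have /centP[uh Tu] := uT; have /centP[vh Tv] := vT.
have bh : fixed_root b by split=> //; exists u, v.
have [_ _ bv] := uv; have [_ bu _] := uv.
have := T_reg b bh; have v0 := weight_vector_neq0 broot uv.
have /eqP := bu T Tt; rewrite Tu eq_sym scaler_eq0 (negbTE v0) orbF oppr_eq0.
by move=> ->.
Qed.

(** On a weight vector u + iv of b, the inequality of scalar products reads
    0 <= b(A) b(T) |v|^2, and b(A) = 0 is excluded because A is regular. *)
Lemma rweight_gt0 T A b :
  T \in t -> A \in t -> cent h A = t -> fixed_root b -> rweight b T = 1 ->
  (forall z, z \in h -> killing (lie A z) (lie T z) <= 0) -> 0 < rweight b A.
Proof.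
move=> Tt At A_reg [broot [u [v [uv uh vh]]]] bT chamber.
have v0 := weight_vector_neq0 broot uv; have [_ bu bv] := uv.
rewrite lt_neqAle; apply/andP; split.
  apply/eqP => bA; have [P Pt bP] := root_rweight_neq0 broot.
  have ut : u \in t.
    by rewrite -A_reg; apply/centP; split; rewrite // bu// -bA oppr0 scale0r.
  have := bu P Pt; rewrite (proj1 t_max)// => /eqP.
  by rewrite eq_sym scaler_eq0 oppr_eq0 (negbTE bP) (negbTE v0).
have := chamber u uh; rewrite bu// bu// bT !killingE.
have vv := g_compact v0.
by rewrite mulN1r mulrN mulNr opprK => ?; rewrite -(nmulr_lle0 _ vv).
Qed.

End FixedRoots.

(** * Action of an involution on roots *)

Section RootAction.
Variables (R : realType) (g : lieAlgType R) (t : {vspace g}).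
Hypothesis g_compact : compact_lie g.
Variable nu : 'End(g).
Hypothesis nu_aut : lie_automorphism nu.
Hypothesis nuK : forall x, nu (nu x) = x.
Hypothesis nu_t : forall P, P \in t -> nu P \in t.
Implicit Types (b : dual_tC t) (P u v : g).

Lemma complexify_map_toC P : (complexify_map nu)^-1%VF (toC P) = toC (nu P).
Proof.
pose F (z : complexification g) : complexification g := (nu z.1, nu z.2).
have F_lin : linear F.
  move=> a z w; apply: gC_ext; rewrite /F /= ?scaleC1 ?scaleC2 !linearD /=.
    by rewrite linearN !linearZ.
  by rewrite !linearZ.
pose L := GRing.isLinear.Build _ _ _ _ F F_lin.
pose FL : {linear complexification g -> complexification g} := HB.pack F L.
have cE z : complexify_map nu z = F z by exact: (lfunE FL z).
have cK : lker (complexify_map nu) == 0%VS.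
  apply/lker0P => [[x1 x2] [y1 y2]]; rewrite !cE /F /=.
  by move=> -[/(can_inj nuK) -> /(can_inj nuK) ->].
apply: (can_inj (lker0_lfunK cK)); rewrite lker0_lfunVK//.
by rewrite cE /F /= nuK linear0.
Qed.

Lemma root_action_emb b P : P \in t -> root_action nu b (emb t P) = b (emb t (nu P)).
Proof.
by move=> Pt; rewrite /root_action !comp_lfunE !lfunE /= embE// complexify_map_toC.
Qed.

Lemma rweight_root_action b P : P \in t -> rweight (root_action nu b) P = rweight b (nu P).
Proof. by move=> Pt; rewrite /rweight root_action_emb. Qed.

Lemma imaginary_root_action b : imaginary b -> imaginary (root_action nu b).
Proof. by move=> ib P Pt; rewrite root_action_emb// ib ?nu_t. Qed.

Lemma root_actionK b : imaginary b -> root_action nu (root_action nu b) = b.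
Proof.
move=> ib; apply: dual_ext => // [|P Pt].
  exact/imaginary_root_action/imaginary_root_action.
by rewrite !rweight_root_action ?nu_t// nuK.
Qed.

Lemma weight_vector_action b u v : weight_vector b u v ->
  weight_vector (root_action nu b) (nu u) (nu v).
Proof.
have nu0 (x : g) : (nu x != 0) = (x != 0) by rewrite -[in RHS](inj_eq (can_inj nuK)) linear0.
move=> [uv0 bu bv]; split=> [|P Pt|P Pt]; first by rewrite !nu0.
  by rewrite -{1}(nuK P) -(proj2 nu_aut) bu ?nu_t// linearZ rweight_root_action.
by rewrite -{1}(nuK P) -(proj2 nu_aut) bv ?nu_t// linearZ rweight_root_action.
Qed.

Lemma fixed_root_action X b :
  (forall x, x \in fixedSpace (exp_end (ad X)) -> nu x \in fixedSpace (exp_end (ad X))) ->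
  fixed_root X b -> fixed_root X (root_action nu b).
Proof.
move=> nu_h [broot [u [v [uv uh vh]]]].
have ib := root_imaginary g_compact broot.
have uv' := weight_vector_action uv.
split; last by exists (nu u), (nu v); split=> //; exact: nu_h.
apply: weight_vector_root uv'; last exact: imaginary_root_action.
apply/eqP => b0; case: (broot) => /eqP bn0 _; apply: bn0.
by rewrite -(root_actionK ib) b0 /root_action !comp_lfun0l.
Qed.

End RootAction.

(** * The simple roots of h *)

Section SimpleRootsOfFixed.
Variables (R : realType) (g : lieAlgType R).
Hypothesis g_compact : compact_lie g.
Variable t : {vspace g}.
Hypothesis t_max : max_abelian_subalg t.
Variables (n : nat) (alpha : 'I_n -> dual_tC t).
Hypothesis alpha_simple : simple_roots alpha.
Variable m : 'I_n -> nat.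
Local Notation delta := (\sum_j alpha j *+ m j).
Hypothesis m_highest : highest_root alpha delta.
Variable K : 'I_n -> subvs_of (complexify_space t).
Hypothesis K_dual : forall j k, alpha j (K k) = (j == k)%:R.
Variable i : 'I_n.
Hypothesis mi : m i = 3%N \/ m i = 4%N.
Variable X : g.
Hypothesis XE : toC X = ((pi / 2)%:C * 'i%C) *: vsval (K i).
Local Notation h := (fixedSpace (exp_end (ad X))).
Hypothesis th : (t <= h)%VS.

Lemma X_in_t : X \in t.
Proof.
have : toC X \in complexify_space t by rewrite XE memvZ// subvsP.
by move=> /complexify_spaceP[].
Qed.

Lemma alpha_imaginary j : imaginary (alpha j).
Proof. by case: alpha_simple => alpha_root _ _; exact: root_imaginary. Qed.

Lemma rweight_alpha_X j : rweight (alpha j) X = (pi / 2) *+ (j == i).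
Proof.
have -> : rweight (alpha j) X = complex.Im (alpha j (((pi / 2)%:C * 'i%C) *: K i)).
  congr (complex.Im (alpha j _)); apply: subvs_inj.
  by rewrite embE ?X_in_t// XE linearZ.
rewrite linearZ /= K_dual -[_ *: _]/(_ * _).
by case: (j == i); rewrite ?mulr1 ?mulr0 /= ?mulr0 ?mulr1 ?mul0r ?addr0 ?add0r.
Qed.

(** K_k takes real values on the simple roots, which are imaginary on t, so K_k
    is - i times this element of t: these are the real coweights. *)
Definition coweight k : g := - (vsval (K k)).2.

Lemma coweight_in k : coweight k \in t.
Proof. by rewrite memvN subvs_im. Qed.

Lemma rweight_coweight j k : rweight (alpha j) (coweight k) = (j == k)%:R.
Proof.
rewrite rweightNr; have := K_dual j k; rewrite {1}[K k]emb_decomp linearD linearZ /= /rweight.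
move: (alpha_imaginary j (subvs_re (K k))) (alpha_imaginary j (subvs_im (K k))).
case: (alpha j _) (alpha j _) => [a1 a2] [c1 c2] /= -> ->.
rewrite -[_ *: _]/(_ * _) => /(congr1 (@complex.Re R)) /=.
by case: (j == k) => /=; lra.
Qed.

Lemma rweight_sum_coweight (c : 'I_n -> nat) k :
  rweight (\sum_j alpha j *+ c j) (coweight k) = (c k)%:R.
Proof.
rewrite rweight_sum (bigD1 k)//= rweightMn rweight_coweight eqxx big1 ?addr0// => j jk.
by rewrite rweightMn rweight_coweight (negbTE jk) mul0rn.
Qed.

Lemma rweight_sum_X (c : 'I_n -> nat) : rweight (\sum_j alpha j *+ c j) X = (pi / 2) *+ c i.
Proof.
rewrite rweight_sum (bigD1 i)//= rweightMn rweight_alpha_X eqxx big1 ?addr0// => j ji.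
by rewrite rweightMn rweight_alpha_X (negbTE ji) mulr0n mul0rn.
Qed.

(** The simple roots of h are the beta j for the j that satisfy simple_h: the
    index i is reused for the lowest root, which is simple only if m_i = 4. *)
Definition beta j := if j == i then - delta else alpha j.
Definition simple_h j := (j != i) || (m i == 4%N).

Lemma simple_roots_hE b :
  simple_roots_h alpha m i b <-> exists2 j, simple_h j & b = beta j.
Proof.
rewrite /simple_h /beta; split=> [[[mi4 ->]|[j ji ->]]|[j]].
- by exists i; rewrite ?mi4 ?eqxx ?orbT.
- by exists j; rewrite ?ji ?(negbTE ji).
- by case: eqP => [_ /= /eqP mi4 ->|/eqP ji _ ->]; [left | right; exists j].
Qed.

Lemma beta_fixed_root j : simple_h j -> fixed_root X (beta j).
Proof.
have [alpha_root _ _] := alpha_simple; rewrite /simple_h /beta.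
case: eqP => [_ /= /eqP mi4|/eqP ji _].
  apply: fixed_root_opp => //.
  have dX : rweight delta X = pi *+ 2.
    by rewrite rweight_sum_X mi4 -[LHS]mulr_natr -[RHS]mulr_natr; field.
  apply: (root_fixed g_compact X_in_t) => //; rewrite ?dX ?cos2pi ?sin2pi //.
  by case: m_highest.
have aX : rweight (alpha j) X = 0 by rewrite rweight_alpha_X (negbTE ji).
by apply: (root_fixed g_compact X_in_t); rewrite // aX ?cos0 ?sin0.
Qed.

(** sigma acts on the root space of b through the angle c_i pi/2, so 4 divides
    c_i; comparison with the highest root gives c_i <= m_i <= 4. *)
Lemma fixed_root_coeff b (c : 'I_n -> nat) : fixed_root X b ->
  b = \sum_j alpha j *+ c j -> c i = 0%N \/ (c i = 4%N /\ m i = 4%N).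
Proof.
move=> bh bE; have cos1 := fixed_root_cos g_compact X_in_t bh.
have [broot _] := bh.
have [dd ddE] := proj2 m_highest b broot.
have cdm : (m i = dd i + c i)%N.
  have := congr1 (fun a => rweight a (coweight i)) ddE.
  rewrite rweightD rweightN bE !rweight_sum_coweight => /eqP; rewrite subr_eq -natrD eqr_nat.
  by move/eqP.
move: cos1; rewrite bE rweight_sum_X.
have cm : (c i <= 4)%N by case: mi => mE; rewrite mE in cdm; lia.
have z1 : 0 <> 1 :> R by apply/eqP; rewrite eq_sym oner_eq0.
have m1 : - 1 <> 1 :> R.
  by apply/eqP; rewrite eq_sym -subr_eq0 opprK -[1 + 1]/(2%:R) pnatr_eq0.
have e2 : (pi / 2) *+ 2 = pi :> R by rewrite -mulr_natr divfK ?pnatr_eq0.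
have e3 : (pi / 2) *+ 3 = pi / 2 + pi :> R by rewrite mulrS e2.
case: (c i) cdm cm => [|[|[|[|[|//]]]]] cdm _ cos1; first by left.
- by move: cos1; rewrite mulr1n cos_pihalf => /z1.
- by move: cos1; rewrite e2 cospi => /m1.
- by move: cos1; rewrite e3 cosDpi cos_pihalf oppr0 => /z1.
by right; split=> //; case: mi => mE; lia.
Qed.

(** If c_i = m_i = 4, then delta - b does not involve alpha_i, so that
    b = - (- delta + (delta - b)) is minus a sum of simple roots of h. *)
Lemma fixed_root_simple_sum_pos b (c : 'I_n -> nat) : fixed_root X b ->
  b = \sum_j alpha j *+ c j ->
  exists c' : 'I_n -> nat, b = \sum_(j | simple_h j) beta j *+ c' j \/
                           b = - \sum_(j | simple_h j) beta j *+ c' j.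
Proof.
move=> bh bE.
have sumE (c' : 'I_n -> nat) :
    \sum_(j | simple_h j) beta j *+ c' j =
    \sum_(j | j != i) alpha j *+ c' j - (if m i == 4%N then delta *+ c' i else 0).
  rewrite big_mkcond (bigD1 i)//= addrC; congr (_ + _).
    apply: eq_bigr => j ji; rewrite /simple_h /beta ji (negbTE ji) //.
  rewrite /simple_h /beta eqxx /=; case: eqP => _; last by rewrite oppr0.
  by rewrite mulNrn.
have [ci|[ci mi4]] := fixed_root_coeff bh bE.
  exists c; left; rewrite sumE ci mulr0n if_same subr0.
  by rewrite bE (bigD1 i)//= ci mulr0n add0r.
have [broot _] := bh; have [dd ddE] := proj2 m_highest b broot.
exists (fun j => if j == i then 1%N else dd j); right.
rewrite sumE mi4 !eqxx opprB mulr1n.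
have ddi : dd i = 0%N.
  have := congr1 (fun a => rweight a (coweight i)) ddE.
  rewrite rweightD rweightN bE !rweight_sum_coweight ci mi4 subrr => /eqP.
  by rewrite eq_sym pnatr_eq0 => /eqP.
have -> : \sum_(j | j != i) alpha j *+ (if j == i then 1%N else dd j) =
    \sum_(j | j != i) alpha j *+ dd j.
  by apply: eq_bigr => j /negbTE ->.
move: ddE; rewrite [RHS](bigD1 i)//= ddi mulr0n add0r => <-.
by rewrite subKr.
Qed.

Lemma fixed_root_simple_sum b : fixed_root X b ->
  exists c : 'I_n -> nat, b = \sum_(j | simple_h j) beta j *+ c j \/
                          b = - \sum_(j | simple_h j) beta j *+ c j.
Proof.
move=> bh; have [broot _] := bh; have [_ _ dec] := alpha_simple.
have [c [bE|bE]] := dec b broot; first exact: fixed_root_simple_sum_pos bE.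
have [|c' [b'|b']] := @fixed_root_simple_sum_pos (- b) c (fixed_root_opp g_compact bh).
- by rewrite bE opprK.
- by exists c'; right; rewrite -b' opprK.
- by exists c'; left; rewrite -[b]opprK b' opprK.
Qed.

(** This T computes heights of roots of h. Its value at alpha_i is forced, when
    m_i = 4, by the value 1 at the lowest root. *)
Lemma exists_height : exists2 T, T \in t & forall j, simple_h j -> rweight (beta j) T = 1.
Proof.
pose S : R := \sum_(j | j != i) (m j)%:R.
pose ci : R := - (1 + S) / 4.
pose T := \sum_j (if j == i then ci else 1) *: coweight j.
have rwT j : rweight (alpha j) T = if j == i then ci else 1.
  rewrite rweight_sumr (bigD1 j)//= rweightZr rweight_coweight eqxx mulr1 big1 ?addr0// => k kj.
  by rewrite rweightZr rweight_coweight [j == k]eq_sym (negbTE kj) mulr0.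
exists T; first by apply: memv_suml => j _; rewrite memvZ// coweight_in.
move=> j; rewrite /simple_h /beta; case: eqP => [_ /= /eqP mi4|/eqP/negbTE ji _]; last first.
  by rewrite rwT ji.
rewrite rweightN rweight_sum (bigD1 i)//= rweightMn rwT eqxx mi4.
rewrite (eq_bigr (fun j => (m j)%:R)) => [|k /negbTE ki]; last by rewrite rweightMn rwT ki.
by rewrite -/S /ci -mulr_natr; field.
Qed.

End SimpleRootsOfFixed.

(** * Symmetries that preserve positive roots *)

(** The symmetry w sends a simple root to a positive root, and if that were a sum
    of several simple roots, then applying w again would write a simple root, of
    height 1, as a sum of several positive roots. Here ht is the height, ht' is
    the height composed with w, and pos is a functional that defines
    positivity. *)
Lemma base_permuted (R : realType) (V : zmodType) (I : finType) (p : pred I)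
    (beta : I -> V) (Phi : V -> Prop) (w : V -> V) (ht ht' pos : V -> R) :
  {morph ht : x y / x + y} -> {morph ht' : x y / x + y} ->
  {morph pos : x y / x + y} ->
  (forall j, p j -> [/\ Phi (beta j), ht (beta j) = 1 & 0 < pos (beta j)]) ->
  (forall b, Phi b -> b != 0) ->
  (forall b, Phi b -> exists c : I -> nat,
     b = \sum_(j | p j) beta j *+ c j \/ b = - \sum_(j | p j) beta j *+ c j) ->
  (forall b, Phi b -> [/\ Phi (w b), pos (w b) = pos b, ht (w b) = ht' b &
     ht' (w b) = ht b]) ->
  forall j, p j -> exists2 k, p k & w (beta j) = beta k.
Proof.
move=> htD htD' posD base Phi0 dec wP.
have morph_sum (f : V -> R) (c : I -> nat) : {morph f : x y / x + y} ->
    f (\sum_(j | p j) beta j *+ c j) = \sum_(j | p j) f (beta j) *+ c j.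
  move=> fD; have f0 : f 0 = 0 by apply: (addrI (f 0)); rewrite -fD !addr0.
  rewrite (big_morph f fD f0); apply: eq_bigr => j _.
  by elim: (c j) => [|k IHk]; rewrite ?mulr0n// !mulrS fD IHk.
have pos_dec b : Phi b -> 0 < pos b ->
    exists c : I -> nat, b = \sum_(j | p j) beta j *+ c j.
  move=> Pb b_pos; have [c [bE|bE]] := dec b Pb; first by exists c.
  have : 0 <= pos (- b).
    rewrite bE opprK morph_sum//; apply: sumr_ge0 => j pj.
    by have [_ _ /ltW b0] := base j pj; exact: mulrn_wge0.
  have : pos b + pos (- b) = 0.
    by rewrite -posD subrr; apply: (addrI (pos 0)); rewrite -posD !addr0.
  by move: b_pos; lra.
have ht_nat b : Phi b -> 0 < pos b -> exists2 N, (0 < N)%N & ht b = N%:R.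
  move=> Pb b_pos; have [c bE] := pos_dec b Pb b_pos.
  exists (\sum_(j | p j) c j)%N; last first.
    rewrite bE morph_sum// natr_sum; apply: eq_bigr => j pj.
    by have [_ -> _] := base j pj.
  rewrite lt0n sum_nat_eq0; apply/negP => /forall_inP c0.
  have := Phi0 b Pb; rewrite bE big1 ?eqxx// => j pj.
  by rewrite (eqP (c0 j pj)) mulr0n.
move=> j pj; have [Pj htj posj] := base j pj; have [Pwj pos_wj _ ht_wj] := wP _ Pj.
have [c wE] : exists c : I -> nat, w (beta j) = \sum_(k | p k) beta k *+ c k.
  by apply: pos_dec => //; rewrite pos_wj.
have Nex k : exists N, p k -> (0 < N)%N /\ ht' (beta k) = N%:R.
  have [pk|npk] := boolP (p k); last by exists 0%N.
  have [Pk _ posk] := base k pk; have [Pwk pos_wk ht_wk _] := wP _ Pk.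
  have [|N N0 htN] := ht_nat _ Pwk; first by rewrite pos_wk.
  by exists N => _; rewrite -ht_wk.
have [N NP] := choice Nex.
have : (\sum_(k | p k) N k * c k)%N == 1%N.
  rewrite -(eqr_nat R) natr_sum; apply/eqP; transitivity (ht (beta j)) => //.
  rewrite -ht_wj wE morph_sum//; apply: eq_bigr => k pk; have [_ ->] := NP k pk.
  by rewrite natrM mulr_natr.
move=> /sum_nat_eq1[k [pk /eqP]]; rewrite muln_eq1 => /andP[_ /eqP ck] c0.
exists k => //; rewrite wE (bigD1 k)//= ck mulr1n big1 ?addr0// => l /andP[pl lk].
have /eqP := c0 l lk pl; rewrite muln_eq0 => /orP[/eqP Nl|/eqP ->]; last by rewrite mulr0n.
by have [] := NP l pl; rewrite Nl.
Qed.

Theorem lemma3p4 (R : realType) (g : lieAlgType R)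
  (g_compact : compact_lie g) (g_simple : simple_lie g)
  (t : {vspace g}) (t_max : max_abelian_subalg t)
  (n : nat) (alpha : 'I_n -> dual_tC t) (alpha_simple : simple_roots alpha)
  (m : 'I_n -> nat)
  (m_highest : highest_root alpha (\sum_j alpha j *+ m j))
  (K : 'I_n -> subvs_of (complexify_space t))
  (K_dual : forall j k, alpha j (K k) = (j == k)%:R)
  (i : 'I_n) (mi : m i = 3%N \/ m i = 4%N)
  (X : g) (XE : toC X = ((pi / 2)%:C * 'i%C) *: vsval (K i))
  (sigma : 'End(g)) (sigmaE : sigma = exp_end (ad X))
  (h : {vspace g}) (hE : h = fixedSpace sigma) (th : (t <= h)%VS)
  (tau : 'End(g)) (tau_inv : involutive_automorphism tau)
  (tau_h : (tau @: h)%VS = h) :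
  exists2 mu : 'End(g), Int_group h mu &
    let nu := (mu \o tau \o mu^-1)%VF in
    (nu @: t)%VS = t /\
    [set root_action nu b | b in simple_roots_h alpha m i] =
      simple_roots_h alpha m i.
Proof.
subst sigma h; have sigma_aut := exp_ad_automorphism X.
set h := fixedSpace _ in th tau_h *.
have h_sub : lie_subalg h by exact: fixed_subalg.
have Xt := X_in_t XE.
have [A [Ah tauA A_reg]] := involution_fixed_regular g_compact h_sub tau_inv tau_h.
have [T Tt T1] := exists_height g_compact alpha_simple m K_dual i.
have simple_sum := fixed_root_simple_sum g_compact alpha_simple m_highest K_dual mi XE th.
have Phi0 (b : dual_tC t) : fixed_root X b -> b != 0 by case=> -[].
have T_neq0 (b : dual_tC t) : fixed_root X b -> rweight b T != 0.
  move=> bX; have sum_neq0 c : \sum_(j | simple_h m i j) beta alpha m i j *+ c j != 0 ->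
      rweight (\sum_(j | simple_h m i j) beta alpha m i j *+ c j) T != 0.
    have -> : rweight (\sum_(j | simple_h m i j) beta alpha m i j *+ c j) T =
        (\sum_(j | simple_h m i j) c j)%:R.
      by rewrite rweight_sum natr_sum; apply: eq_bigr => j pj; rewrite rweightMn T1.
    rewrite pnatr_eq0 sum_nat_eq0; apply: contra => /forall_inP c0.
    by apply/eqP/big1 => j pj; rewrite (eqP (c0 j pj)) mulr0n.
  have b0 := Phi0 b bX.
  have [c [bE|bE]] := simple_sum b bX; rewrite bE ?rweightN ?oppr_eq0; apply: sum_neq0.
    by rewrite -bE.
  by rewrite -oppr_eq0 -bE.
have T_reg := regular_of_roots g_compact t_max th Tt T_neq0.
have [mu [Imu At A_cent chamber]] :=
  torus_chamber_conjugacy g_compact sigma_aut t_max th Tt T_reg Ah A_reg.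
exists mu => //= ; set nu := (mu \o tau \o mu^-1)%VF.
have mu_aut := Int_group_aut Imu; have [tau_aut tau2] := tau_inv.
have nuE x : nu x = mu (tau (mu^-1%VF x)) by rewrite !comp_lfunE.
have nu_aut : lie_automorphism nu.
  exact: automorphism_comp (automorphism_comp mu_aut tau_aut) (automorphism_inv mu_aut).
have nuK x : nu (nu x) = x.
  rewrite !nuE (automorphismK mu_aut) -[tau (tau _)]comp_lfunE tau2 id_lfunE.
  exact: automorphismVK.
have nuA : nu (mu A) = mu A by rewrite nuE (automorphismK mu_aut) tauA.
have nu_h x : x \in h -> nu x \in h.
  move=> xh; rewrite nuE; apply: (Int_group_stable sigma_aut Imu).
  rewrite -/h -tau_h memv_img//; apply: (Int_group_stable sigma_aut) => //.
  exact: Int_inv.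
have nu_t P : P \in t -> nu P \in t.
  rewrite -A_cent => /centP[Ph AP]; apply/centP; split; first exact: nu_h.
  by rewrite -nuA -(proj2 nu_aut) AP linear0.
split.
  apply/vspaceP => P; apply/idP/idP => [/memv_imgP[Q Qt ->]|Pt]; first exact: nu_t.
  by rewrite -(nuK P) memv_img// nu_t.
have base_fixed := beta_fixed_root g_compact alpha_simple m_highest K_dual XE.
have perm j : simple_h m i j ->
    exists2 k, simple_h m i k & root_action nu (beta alpha m i j) = beta alpha m i k.
  apply: (@base_permuted R _ _ (simple_h m i) (beta alpha m i) (fixed_root X)
    (root_action nu) (fun b => rweight b T) (fun b => rweight b (nu T))
    (fun b => rweight b (mu A))).
  - by move=> b1 b2; rewrite rweightD.
  - by move=> b1 b2; rewrite rweightD.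
  - by move=> b1 b2; rewrite rweightD.
  - move=> k pk; split; rewrite ?T1//; first exact: base_fixed.
    by apply: (rweight_gt0 g_compact t_max Tt At A_cent (base_fixed k pk)) => //; exact: T1.
  - exact: Phi0.
  - exact: simple_sum.
  move=> b bX; split; rewrite ?rweight_root_action// ?nuA ?nuK ?nu_t//.
  exact: fixed_root_action.
have base_im j : simple_h m i j -> imaginary (beta alpha m i j).
  by move=> pj; have [broot _] := base_fixed j pj; exact: root_imaginary.
apply/seteqP; split=> [_ [b /simple_roots_hE[j pj ->] <-]|b /simple_roots_hE[j pj ->]].
  by have [k pk ->] := perm j pj; apply/simple_roots_hE; exists k.
have [k pk wj] := perm j pj; exists (beta alpha m i k).
  by apply/simple_roots_hE; exists k.
by rewrite -wj root_actionK//; exact: base_im.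
Qed.
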